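(* Let $d\ge 1$ be an integer. For any constant $\varepsilon>0$ there is an $\varepsilon$-differentially private online synthetic data generation algorithm such that, for any infinite data stream $x_1,x_2,\dots,x_t,\dots\in[0,1]^d$, at any time $t\ge 1$ it transforms the first $t$ points $\mathcal X_t=(x_1,\dots,x_t)$ into $t$ points $\mathcal Y_t=(y_{1,t},\dots,y_{t,t})$ in $[0,1]^d$, with the following accuracy bound: there exists a constant $C_\varepsilon$ depending only on $\varepsilon$ such that for all $t\ge C_\varepsilon$, $$\mathbb E\, W_1(\mu_{\mathcal X_t},\mu_{\mathcal Y_t})\lesssim \begin{cases}\log(t)\,(\varepsilon t)^{-1/d}, & d\ge 2,\\ \log^3(\varepsilon t)\,\log^{1.5}(t)\,(\varepsilon t)^{-1}, & d=1,\end{cases}$$ where $\mu_{\mathcal X_t}=\frac1t\sum_{i=1}^t\delta_{x_i}$ and $\mu_{\mathcal Y_t}=\frac1t\sum_{i=1}^t\delta_{y_{i,t}}$ are the empirical measures of $\mathcal X_t$ and $\mathcal Y_t$.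
   Context: A dataset is an infinite sequence $\mathcal X=(x_1,x_2,\dots)$ with $x_t\in[0,1]^d$ arriving at time $t\in\mathbb Z_+=\{1,2,\dots\}$. Two datasets are neighbors if they differ in at most one coordinate. An online synthetic data generation algorithm $\mathcal M$ (with infinite time horizon) is a randomized algorithm that maps $\mathcal X$ to an infinite sequence of synthetic datasets $\mathcal M(\mathcal X)=(\mathcal Y_1,\mathcal Y_2,\dots)$, where $\mathcal Y_t=(y_{1,t},\dots,y_{t,t})\in([0,1]^d)^t$ is produced at time $t$ from $\mathcal X_t=(x_1,\dots,x_t)$ and the algorithm's internal randomness (which may be shared across times). It is not required that $\mathcal Y_{t-1}\subset\mathcal Y_t$. The algorithm $\mathcal M$ is $\varepsilon$-differentially private if for any two neighboring datasets $\mathcal X,\mathcal X'$ and any measurable set $S$ of infinite output sequences, $\mathbb P(\mathcal M(\mathcal X)\in S)\le e^{\varepsilon}\,\mathbb P(\mathcal M(\mathcal X')\in S)$. The cube $[0,1]^d$ is equipped with the $\ell_\infty$-metric $\rho$, and $W_1(\mu,\nu)=\inf_{\gamma}\int\rho(x,y)\,d\gamma(x,y)$, the infimum being over all couplings $\gamma$ of $\mu$ and $\nu$. The expectation is over the randomness of the algorithm (the data stream is deterministic). $A\lesssim B$ means $A\le CB$ for an absolute constant $C>0$. *)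

(* Defs.v *)
From HB Require Import structures.
From mathcomp Require Import all_boot all_order all_algebra.
From mathcomp Require Import all_classical all_reals all_analysis.

Set Implicit Arguments.
Unset Strict Implicit.
Unset Printing Implicit Defensive.

Import Order.TTheory GRing.Theory Num.Theory.
Import numFieldNormedType.Exports.

Local Open Scope classical_set_scope.
Local Open Scope ring_scope.

(* [set_type] carries the subspace topology inherited from 'rV[R]_d. *)
Definition cube (R : realType) (d : nat) : Type :=
  set_type [set x : 'rV[R]_d | forall i, 0 <= x ord0 i <= 1].

Lemma cube_inhabited (R : realType) (d : nat) :
  (0 : 'rV[R]_d) \in [set x : 'rV[R]_d | forall i, 0 <= x ord0 i <= 1].
Proof. by rewrite inE /= => i; rewrite mxE lexx ler01. Qed.

HB.instance Definition _ (R : realType) (d : nat) := Topological.on (cube R d).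
HB.instance Definition _ (R : realType) (d : nat) :=
  isPointed.Build (cube R d) (exist _ 0 (cube_inhabited R d)).

(* The Borel sigma-algebra. *)
HB.instance Definition _ (R : realType) (d : nat) :=
  @isMeasurable.Build (sigma_display (@open (cube R d))) (cube R d)
    <<s @open (cube R d) >> (@sigma_algebra0 _ setT _)
    (@sigma_algebraC (cube R d) _) (@sigma_algebra_bigcup _ setT _).

(* The norm of 'rV[R]_d is the maximum of the absolute values of the entries. *)
Definition rho (R : realType) (d : nat) (x y : cube R d) : R :=
  `|\val x - \val y|.

Definition coupling (R : realType) (d : nat)
    (mu nu : {measure set (cube R d) -> \bar R})
    (gamma : probability (cube R d * cube R d)%type R) : Prop :=
  forall A : set (cube R d), measurable A ->
    pushforward gamma fst A = mu A /\ pushforward gamma snd A = nu A.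

Definition W1 (R : realType) (d : nat)
    (mu nu : {measure set (cube R d) -> \bar R}) : \bar R :=
  ereal_inf [set \int[gamma]_z (rho z.1 z.2)%:E | gamma in coupling mu nu]%E.

(* (1/t) * (sum of the Dirac masses at the t points of xs); [point] is only the
   out-of-range default of [nth]. *)
Definition empirical (R : realType) (d t : nat) (xs : t.-tuple (cube R d)) :
    {measure set (cube R d) -> \bar R} :=
  mscale (t%:R^-1)%:nng (msum (fun i => dirac (nth point xs i)) t).

(* Time is 1-based in the mathematics and sequences are 0-based here:
   [x i] is the point x_(i+1), which arrives at time i+1. *)
Definition dataset (R : realType) (d : nat) : Type := nat -> cube R d.

Definition data_upto (R : realType) (d : nat) (x : dataset R d) (t : nat) :
    t.-tuple (cube R d) :=
  [tuple x i | i < t].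

Definition neighbors (R : realType) (d : nat) (x x' : dataset R d) : Prop :=
  exists k : nat, forall i : nat, i != k -> x i = x' i.

(* [y t] is the synthetic dataset Y_t of time t >= 1; [y 0] is the empty tuple
   and carries no information. *)
Definition outputs (R : realType) (d : nat) : Type :=
  forall t : nat, t.-tuple (cube R d).

Definition output_cylinders (R : realType) (d : nat) : set (set (outputs R d)) :=
  \bigcup_(t : nat)
    preimage_set_system setT (fun y : outputs R d => y t) measurable.

HB.instance Definition _ (R : realType) (d : nat) :=
  gen_eqMixin (outputs R d).
HB.instance Definition _ (R : realType) (d : nat) :=
  gen_choiceMixin (outputs R d).
HB.instance Definition _ (R : realType) (d : nat) :=
  isPointed.Build (outputs R d) (fun t => [tuple point | i < t]).

(* The product sigma-algebra. *)
HB.instance Definition _ (R : realType) (d : nat) :=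
  @isMeasurable.Build (sigma_display (@output_cylinders R d)) (outputs R d)
    <<s @output_cylinders R d >> (@sigma_algebra0 _ setT _)
    (@sigma_algebraC (outputs R d) _) (@sigma_algebra_bigcup _ setT _).

(* All times share the one random seed [w : seed M], drawn from [law M]; the
   type of [synth] makes Y_t a function of x_1, ..., x_t and the seed only. *)
Record online_algorithm (R : realType) (d : nat) := OnlineAlgorithm {
  seed_display : measure_display;
  seed : measurableType seed_display;
  law : probability seed R;
  synth : forall t : nat, t.-tuple (cube R d) -> seed -> t.-tuple (cube R d);
  measurable_synth : forall (t : nat) (xs : t.-tuple (cube R d)),
    measurable_fun setT (synth xs)
}.

Definition run (R : realType) (d : nat) (M : online_algorithm R d)
    (x : dataset R d) (w : seed M) : outputs R d :=
  fun t => synth (data_upto x t) w.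

Definition differentially_private (R : realType) (d : nat) (eps : R)
    (M : online_algorithm R d) : Prop :=
  forall x x' : dataset R d, neighbors x x' ->
  forall S : set (outputs R d), measurable S ->
    (law M (run x @^-1` S) <= (expR eps)%:E * law M (run x' @^-1` S))%E.

Definition expected_W1 (R : realType) (d : nat) (M : online_algorithm R d)
    (x : dataset R d) (t : nat) : \bar R :=
  \int[law M]_w W1 (empirical (data_upto x t)) (empirical (run x w t)).

Definition accuracy_rate (R : realType) (d : nat) (eps : R) (t : nat) : R :=
  if d == 1%N then
    ln (eps * t%:R) ^+ 3 * ln t%:R `^ (3 / 2) * (eps * t%:R)^-1
  else
    ln t%:R * (eps * t%:R) `^ (- d%:R^-1).

(* Main.v *)
Require Import Defs.
From HB Require Import structures.
From mathcomp Require Import all_boot all_order all_algebra.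
From mathcomp Require Import all_classical all_reals all_analysis.
From mathcomp Require Import measurable_realfun.
From mathcomp Require Import zify ring lra.

Set Implicit Arguments.
Unset Strict Implicit.
Unset Printing Implicit Defensive.

Import Order.TTheory GRing.Theory Num.Theory.
Import numFieldNormedType.Exports.

Local Open Scope classical_set_scope.
Local Open Scope ring_scope.

(** The algorithm is a binary-counting mechanism in time combined with a
    hierarchical histogram in space.

    Time is cut into epochs of doubling length, and every time [t] closes one
    dyadic block of its epoch, as in a Fenwick tree.  Each prefix of the stream is
    a disjoint union of blocks among which a given block size occurs at most three
    times ([flatten_chain], [sum_chain_le]), while a given point lies in at most
    one block of each size, all of them in the epoch of the point
    ([covers_epoch], [covers_inj], [sum_covers]).

    When a block of [n] points closes, the numbers of its points in the dyadic
    cubes of side [2^-1], ..., [2^-L] are perturbed by the exponential mechanism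
    with rate [eta] ([noise_dp], [noise_err]), and the synthetic block consists of
    the [n] grid points whose own counts fit the perturbed ones best ([fit]).  The
    synthetic dataset of time [t] is the concatenation of the synthetic blocks of
    the prefix.  Fitting is post-processing, so it costs no privacy.

    Accuracy of a block is measured by the cost of a matching between data and
    synthetic points.  Matching greedily from the smallest cubes upwards makes the
    number of pairs separated at side [2^-l] equal to half the discrepancy of the
    counts at that side, at all sides simultaneously ([greedy_matching]); such a
    pair is at distance at most the sum of the sides at which it is separated plus
    [2^-L] ([dist_le_levels]).  Taking expectations, a block costs at most
    [n 2^-L + (2 / eta) * sum_(1 <= l <= L) 2^-l 2^(l d)] ([expected_score]).

    In the epoch [e] the rate is of order [eps / e^2]: one factor [e] pays for the
    blocks that contain a point, the other for the scales of the histogram.  The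
    depth balances both terms, [2^(L d)] being about [eta n].  If [d >= 2], a block
    then costs [O(n (eta n)^(-1/d))], the sum over the block sizes is geometric,
    and division by [t] leaves [(eta t)^(-1/d)], where the loss [e^(2/d) <= e] is
    the logarithm in the rate ([chain_bound_multi]).  If [d = 1], each of the
    [O(e)] blocks costs [O(e / eta)], in total [O(e^4 / eps)], which is at most the
    rate because [log (eps t)] is at least half of [log t] for large [t]
    ([chain_bound_line]).

    All randomness is read off a single uniform seed by successive inverse-CDF
    draws: what remains of the seed after a draw is again uniform and independent
    of the drawn value ([unit_law_split]).  This replaces an infinite product
    measure, and it reduces privacy of the whole infinite output to an induction
    on the finitely many draws whose law depends on the point that is changed
    ([dp_draws]). *)

(** * Random integers drawn from one uniform seed *)

Section Unit.
Variable R : realType.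
Local Notation mu := (@lebesgue_measure R).

Definition unit_law : set (measurableTypeR R) -> \bar R :=
  mrestr mu (measurable_itv `[0%R, 1%R[).

HB.instance Definition _ := Measure.on unit_law.

Lemma unit_lawT : unit_law setT = 1%E.
Proof.
by rewrite /unit_law /mrestr setTI lebesgue_measure_itv/= lte_fin ltr01 oppr0 adde0.
Qed.
HB.instance Definition _ := Measure_isProbability.Build _ _ _ unit_law unit_lawT.

Lemma unit_lawE A : unit_law A = mu (A `&` `[0%R, 1%R[).
Proof. by []. Qed.

Lemma measurable_affine (b a : R) :
  measurable_fun setT (fun u : measurableTypeR R => (u - b) / a : measurableTypeR R).
Proof.
apply: measurable_funM; last exact: measurable_cst.
by apply: measurable_funB; [exact: measurable_id|exact: measurable_cst].
Qed.

(** Both sides are measures in [A], so half-open intervals suffice. *)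
Lemma lebesgue_affine (b a : R) (A : set (measurableTypeR R)) :
  0 < a -> measurable A ->
  mu [set u | A ((u - b) / a)] = (a%:E * mu A)%E.
Proof.
move=> a0 mA.
pose f : measurableTypeR R -> measurableTypeR R := fun u => (u - b) / a.
have mf : measurable_fun setT f by exact: measurable_affine.
pose f' : {mfun measurableTypeR R >-> measurableTypeR R} := mfun_Sub (mem_set mf).
have a1 : 0 <= a^-1 by rewrite invr_ge0 ltW.
pose nu : {measure set (measurableTypeR R) -> \bar R} := mscale (NngNum a1) (pushforward mu f').
have -> : mu A = nu mf A.
  apply: lebesgue_measure_unique => // X [[x y] _ <-].
  change (mu `]x, y]%classic = (a^-1%:E * mu (f @^-1` `]x, y]))%E).
  have -> : f @^-1` `]x, y] = `]x * a + b, y * a + b]%classic.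
    apply/seteqP; split => u /=; rewrite !in_itv/= /f ltr_pdivlMr// ler_pdivrMr//; lra.
  rewrite !lebesgue_measure_itv/= !lte_fin.
  rewrite ltrD2r ltr_pM2r//; case: ifPn => _; last by rewrite mule0.
  rewrite -!EFinD -EFinM; congr (_%:E); field; lra.
by rewrite /nu /mscale/= muleA -EFinM divff ?mul1e// gt_eqF.
Qed.

Lemma unit_law_affine (b a : R) (A : set (measurableTypeR R)) :
  0 < a -> 0 <= b -> b + a <= 1 -> measurable A ->
  unit_law (`[b, b + a[ `&` [set u | A ((u - b) / a)]) = (a%:E * unit_law A)%E.
Proof.
move=> a0 b0 ba mA; rewrite !unit_lawE -(lebesgue_affine b a0); last first.
  by apply: measurableI => //; exact: measurable_itv.
congr (mu _); apply/seteqP; split => u /=; rewrite !in_itv/=.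
  move=> [[/andP[u1 u2] Au] _]; split=> //.
  rewrite ltr_pdivrMr// mul1r divr_ge0/= ?subr_ge0// ?ltW//.
  by rewrite ltrBlDl.
move=> [Au /andP[]]; rewrite ltr_pdivrMr// mul1r ler_pdivlMr// mul0r => u1 u2.
by split; [split => //; apply/andP; split; lra | apply/andP; split; lra].
Qed.

Definition is_pmf (q : nat -> R) : Prop :=
  (forall z, 0 <= q z) /\
  exists K, (\sum_(z < K) q z = 1) /\ (forall z, (K <= z)%N -> q z = 0).

Definition cdf (q : nat -> R) (z : nat) : R := \sum_(i < z) q i.

Lemma cdfS q z : cdf q z.+1 = cdf q z + q z.
Proof. by rewrite /cdf big_ord_recr. Qed.

Lemma cdf_mono q : is_pmf q -> {homo cdf q : m n / (m <= n)%N >-> m <= n}.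
Proof.
move=> [q0 _]; apply: homo_leq => [//|x y z|z]; first exact: le_trans.
by rewrite cdfS lerDl.
Qed.

Lemma cdf_ge0 q z : is_pmf q -> 0 <= cdf q z.
Proof. by move=> [q0 _]; apply: sumr_ge0. Qed.

Lemma cdf_le1 q z : is_pmf q -> cdf q z <= 1.
Proof.
move=> pq; have [q0 [K [<- Kq]]] := pq.
rewrite -/(cdf q K).
apply: (le_trans (cdf_mono pq (leq_maxr K z))); rewrite le_eqVlt; apply/orP; left.
rewrite -(subnKC (leq_maxl K z)); elim: (_ - K)%N => [|n IH]; first by rewrite addn0.
by rewrite addnS cdfS Kq ?addr0// leq_addr.
Qed.

(** Inverse-CDF sampling. *)
Definition digit (q : nat -> R) (u : R) : nat :=
  xget 0%N [set z | cdf q z <= u < cdf q z.+1].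

Lemma digit_eq q u z : is_pmf q -> cdf q z <= u < cdf q z.+1 -> digit q u = z.
Proof.
move=> pq zu; rewrite /digit; apply: xget_unique => // w /= wu.
case: (ltngtP z w) => // zw.
  have := cdf_mono pq zw; move: zu wu => /andP[_ h1] /andP[h2 _] h3.
  by have := lt_le_trans h1 (le_trans h3 h2); rewrite ltxx.
have := cdf_mono pq zw; move: zu wu => /andP[h2 _] /andP[_ h1] h3.
by have := lt_le_trans h1 (le_trans h3 h2); rewrite ltxx.
Qed.

Lemma digitP q u : is_pmf q -> 0 <= u < 1 ->
  cdf q (digit q u) <= u < cdf q (digit q u).+1.
Proof.
move=> pq /andP[u0 u1].
have ex : exists z, u < cdf q z.
  by have [_ [K [K1 _]]] := pq; exists K; rewrite /cdf K1.
have := ex_minnP ex; case=> -[|z] uz zmin.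
  by move: uz; rewrite /cdf big_ord0 ltNge u0.
suff zu : cdf q z <= u < cdf q z.+1 by rewrite (digit_eq pq zu).
by rewrite uz andbT leNgt; apply/negP => /zmin; rewrite ltnn.
Qed.

Lemma digit_out q u : is_pmf q -> ~~ (0 <= u < 1) -> digit q u = 0%N.
Proof.
move=> pq uN; rewrite /digit; apply: xgetPN => z /= /andP[z1 z2].
move/negP: uN; apply; apply/andP; split.
  exact: le_trans (cdf_ge0 _ pq) z1.
exact: lt_le_trans z2 (cdf_le1 _ pq).
Qed.

(** The position of the seed inside the interval of its digit, rescaled to the
    unit interval so that it can serve as the seed of the next draw. *)
Definition leftover (q : nat -> R) (u : R) : R :=
  (u - cdf q (digit q u)) / q (digit q u).

Lemma measurable_digit q z : is_pmf q ->
  measurable [set u : measurableTypeR R | digit q u = z].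
Proof.
move=> pq.
pose I z : set (measurableTypeR R) := `[cdf q z, cdf q z.+1[%classic.
have mI y : measurable (I y) by exact: measurable_itv.
case: z => [|z].
  have -> : [set u : measurableTypeR R | digit q u = 0%N] =
      I 0%N `|` ~` `[0%R, 1%R[%classic.
    apply/seteqP; split => u /=.
      move=> u0; have [u01|u01] := boolP (0 <= u < 1).
        by left; have := digitP pq u01; rewrite u0 /I/= in_itv.
      by right; rewrite in_itv; apply/negP.
    rewrite /I/= !in_itv/=; case => [|/negP]; first exact: digit_eq.
    exact: digit_out.
  by apply: measurableU => //; apply: measurableC; exact: measurable_itv.
have -> : [set u : measurableTypeR R | digit q u = z.+1] = I z.+1; last exact: mI.
apply/seteqP; split => u /=; rewrite /I/= in_itv/=; last exact: digit_eq.
have [u01 <-|u01] := boolP (0 <= u < 1); first exact: digitP.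
by rewrite digit_out.
Qed.

Lemma measurable_leftover q : is_pmf q ->
  measurable_fun setT (leftover q : measurableTypeR R -> measurableTypeR R).
Proof.
move=> pq _ A mA; rewrite setTI.
have -> : leftover q @^-1` A = \bigcup_z ([set u | digit q u = z] `&`
   ((fun u => (u - cdf q z) / q z) @^-1` A)).
  apply/seteqP; split => u /=; first by move=> Au; exists (digit q u).
  by move=> [z _ [/= <-]].
apply: bigcupT_measurable => z; apply: measurableI; first exact: measurable_digit.
by rewrite -[X in measurable X]setTI; exact: (measurable_affine (cdf q z) (q z)).
Qed.

(** Given its digit [z], the seed is uniform on an interval of length [q z]; hence
    the leftover is uniform and independent of the digit. *)
Lemma unit_law_split q K (E : nat -> set (measurableTypeR R)) : is_pmf q ->
  \sum_(z < K) q z = 1 -> (forall z, measurable (E z)) ->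
  unit_law [set u | E (digit q u) (leftover q u)] =
  (\sum_(z < K) (q z)%:E * unit_law (E z))%E.
Proof.
move=> pq K1 mE.
pose D (z : nat) : set (measurableTypeR R) :=
  `[cdf q z, cdf q z + q z[ `&` [set u | E z ((u - cdf q z) / q z)].
have mD z : measurable (D z).
  apply: measurableI; first exact: measurable_itv.
  by rewrite -[X in measurable X]setTI; exact: (measurable_affine (cdf q z) (q z)).
have -> : unit_law [set u | E (digit q u) (leftover q u)] =
          unit_law (\big[setU/set0]_(z < K) D z).
  rewrite !unit_lawE; congr (mu _); apply/seteqP; split => u /=; rewrite !in_itv/=.
    move=> [Eu u01]; split => //.
    have du := digitP pq u01.
    have dK : (digit q u < K)%N.
      rewrite ltnNge; apply/negP => /(cdf_mono pq); rewrite /cdf K1 => h.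
      by move: du u01 => /andP[d1 _] /andP[_ u1]; have := lt_le_trans u1 (le_trans h d1); rewrite ltxx.
    rewrite -(bigcup_mkord _ D); exists (digit q u) => //.
    by split => //=; rewrite in_itv/= -cdfS.
  move=> [Du u01]; split => //.
  move: Du; rewrite -(bigcup_mkord _ D) => -[z zK [/=]].
  rewrite in_itv/= -cdfS => zu Eu.
  by rewrite /leftover (digit_eq pq zu).
rewrite measure_bigsetU//; last first.
  apply/trivIsetP => i j _ _ ij; apply/seteqP; split => u //= -[[/= + _] [/= + _]].
  by rewrite !in_itv/= -!cdfS => /(digit_eq pq) di /(digit_eq pq) dj; move: ij; rewrite -di -dj eqxx.
apply: eq_bigr => z _.
have [q0|q0] := eqVneq (q z) 0.
  rewrite q0 mul0e (_ : D z = set0) ?measure0//.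
  by apply/seteqP; split=> u //= [/=]; rewrite in_itv/= q0 addr0 => /andP[/le_lt_trans h /h]; rewrite ltxx.
have q0' : 0 < q z by rewrite lt_def q0; case: pq => ->.
by apply: unit_law_affine; rewrite ?cdf_ge0// -cdfS cdf_le1.
Qed.

Fixpoint draws (q : nat -> nat -> R) (u : R) (m : nat) : nat :=
  if m is m'.+1 then draws (fun i => q i.+1) (leftover (q 0%N) u) m'
  else digit (q 0%N) u.

Lemma measurable_draws q m z : (forall i, is_pmf (q i)) ->
  measurable [set u : measurableTypeR R | draws q u m = z].
Proof.
elim: m q => [|m IH] q pq /=; first exact: measurable_digit.
have := @measurable_leftover (q 0%N) (pq 0%N) measurableT _ (IH (fun i => q i.+1) (fun i => pq i.+1)).
by rewrite setTI.
Qed.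

Lemma unit_law_draws q m z : (forall i, is_pmf (q i)) ->
  unit_law [set u | draws q u m = z] = (q m z)%:E.
Proof.
elim: m q => [|m IH] q pq /=.
  have [q0 [K [K1 Kq]]] := pq 0%N.
  pose E y : set (measurableTypeR R) := [set u | y = z].
  have mE y : measurable (E y).
    have [->|yz] := eqVneq y z; first by rewrite (_ : E z = setT)//; apply/seteqP; split.
    by rewrite (_ : E y = set0)//; apply/seteqP; split => u //= /eqP; rewrite (negbTE yz).
  have -> : [set u | digit (q 0%N) u = z] =
            [set u | E (digit (q 0%N) u) (leftover (q 0%N) u)] by [].
  rewrite (unit_law_split (pq 0%N) K1)//.
  have EE y : unit_law (E y) = (y == z)%:R%:E.
    have [->|yz] := eqVneq y z.
      by rewrite (_ : E z = setT) ?unit_lawT//; apply/seteqP; split.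
    by rewrite (_ : E y = set0) ?measure0//; apply/seteqP; split => u //= /eqP; rewrite (negbTE yz).
  under eq_bigr do rewrite EE -EFinM.
  rewrite sumEFin; congr (_%:E).
  have [zK|zK] := ltnP z K.
    rewrite (bigD1 (Ordinal zK))//= eqxx mulr1 big1 ?addr0// => i iz.
    by rewrite (_ : (i == z :> nat) = false) ?mulr0//; apply/negbTE.
  by rewrite Kq// big1// => i _; rewrite (_ : (i == z :> nat) = false) ?mulr0//; apply/eqP => iz; move: (ltn_ord i); rewrite iz ltnNge zK.
have [q0 [K [K1 Kq]]] := pq 0%N.
pose E (y : nat) : set (measurableTypeR R) := [set u | draws (fun i => q i.+1) u m = z].
have mE y : measurable (E y) by exact: measurable_draws.
have -> : [set u | draws (fun i => q i.+1) (leftover (q 0%N) u) m = z] =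
            [set u | E (digit (q 0%N) u) (leftover (q 0%N) u)] by [].
rewrite (unit_law_split (pq 0%N) K1)//.
under eq_bigr do rewrite /E IH// -EFinM.
by rewrite sumEFin -mulr_suml K1 mul1r.
Qed.

Definition finitary d (H : (nat -> nat) -> outputs R d) : Prop :=
  forall t, exists M, forall s s' : nat -> nat,
    (forall i, (i < M)%N -> s i = s' i) -> H s t = H s' t.

(** The first [M] draws take countably many values, so the preimage of a set is a
    countable union of cylinders of draws. *)
Lemma measurable_finitary_fun (q : nat -> nat -> R) M d (T : measurableType d)
    (G : (nat -> nat) -> T) : (forall i, is_pmf (q i)) ->
  (forall s s', (forall i, (i < M)%N -> s i = s' i) -> G s = G s') ->
  measurable_fun setT (fun u : measurableTypeR R => G (draws q u)).
Proof.
move=> pq GM _ A mA; rewrite setTI.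
pose W (o : option (seq nat)) : set (measurableTypeR R) :=
  if o is Some s then
    [set u | A (G (nth 0%N s)) /\ forall i, (i < M)%N -> draws q u i = nth 0%N s i]
  else set0.
have -> : (fun u => G (draws q u)) @^-1` A = \bigcup_p W (unpickle p).
  apply/seteqP; split => u.
    move=> Au; exists (pickle (mkseq (draws q u) M)) => //; rewrite pickleK.
    split => [|i iM]; last by rewrite nth_mkseq.
    by rewrite (GM _ (draws q u)) // => i iM; rewrite nth_mkseq.
  move=> [p _]; case: (unpickle p) => // s [As us].
  by rewrite /= (GM _ (nth 0%N s)).
apply: bigcupT_measurable => p; case: (unpickle p) => [s|]; last exact: measurable0.
have [As|As] := pselect (A (G (nth 0%N s))); last first.
  by rewrite (_ : W _ = set0)//; apply/seteqP; split => u //= [].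
rewrite (_ : W _ = \bigcap_(i in `I_M) [set u | draws q u i = nth 0%N s i]).
  by apply: bigcap_measurableType => i _; exact: measurable_draws.
by apply/seteqP; split => u /= h; [case: h => _ h i; exact: h | split => // i iM; exact: h].
Qed.

Lemma measurable_finitary q d (H : (nat -> nat) -> outputs R d) (S : set (outputs R d)) :
  (forall i, is_pmf (q i)) -> finitary H -> measurable S ->
  measurable [set u : measurableTypeR R | S (H (draws q u))].
Proof.
move=> pq fH mS.
have mH : measurable_fun setT (fun u : measurableTypeR R => H (draws q u)).
  apply: (@measurability _ _ _ _ _ _ (@output_cylinders R d)) => //.
  move=> _ [_ [t _ [B mB <-]] <-]; rewrite !setTI.
  have [M HM] := fH t.
  have := @measurable_finitary_fun q M _ _ (fun s => H s t) pq HM measurableT B mB.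
  by rewrite setTI.
by have := mH measurableT S mS; rewrite setTI.
Qed.

(** Sequential composition for infinite outputs.  Conditioning on the first draw
    splits both probabilities into sums in which the first factors compare by
    [e 0], while the second factors concern the shifted laws, one fewer of which
    differ; the law of the first value being explicit, no limit is taken. *)
Lemma dp_draws M (q q' : nat -> nat -> R) (e : nat -> R) d
    (H : (nat -> nat) -> outputs R d) (S : set (outputs R d)) :
  (forall i, is_pmf (q i)) -> (forall i, is_pmf (q' i)) -> finitary H ->
  measurable S ->
  (forall i z, q i z <= expR (e i) * q' i z) ->
  (forall i, (M <= i)%N -> q i = q' i) ->
  (unit_law [set u | S (H (draws q u))] <=
   (expR (\sum_(i < M) e i))%:E * unit_law [set u | S (H (draws q' u))])%E.
Proof.
move=> + + + mS; elim: M q q' e H => [|M IH] q q' e H pq pq' fH qe qM.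
  have -> : q = q' by apply/funext => i; exact: qM.
  by rewrite big_ord0 expR0 mul1e.
pose hd z (s : nat -> nat) i := if i is i'.+1 then s i' else z.
pose H' z s := H (hd z s).
have fH' z : finitary (H' z).
  move=> t; have [N HN] := fH t; exists N => s s' ss'; apply: HN.
  by move=> [|i] //= iN; apply: ss'; exact: ltnW.
have hdE (p : nat -> nat -> R) u : H (draws p u) =
    H' (digit (p 0%N) u) (draws (fun i => p i.+1) (leftover (p 0%N) u)).
  by congr H; apply/funext => -[|i].
pose E (p : nat -> nat -> R) (z : nat) : set (measurableTypeR R) :=
  [set u | S (H' z (draws (fun i => p i.+1) u))].
have mE p z : (forall i, is_pmf (p i)) -> measurable (E p z).
  by move=> pp; apply: measurable_finitary.
have EE p : [set u | S (H (draws p u))] = [set u | E p (digit (p 0%N) u) (leftover (p 0%N) u)].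
  by apply/seteqP; split => u /=; rewrite hdE.
have [_ [K [K1 Kq]]] := pq 0%N; have [_ [K' [K1' Kq']]] := pq' 0%N.
have cut (p : nat -> R) k k' : \sum_(z < k) p z = 1 -> (k <= k')%N ->
    (forall z, (k <= z)%N -> p z = 0) -> \sum_(z < k') p z = 1.
  move=> <- kk' p0; rewrite -!(big_mkord xpredT p).
  rewrite [LHS](big_cat_nat (n := k))//= [X in _ + X]big_nat_cond [X in _ + X]big1 ?addr0// => i.
  by rewrite andbT => /andP[/p0].
pose L := maxn K K'.
have {K1}L1 := cut _ _ _ K1 (leq_maxl K K') Kq.
have {K1'}L1' := cut _ _ _ K1' (leq_maxr K K') Kq'.
rewrite !EE (unit_law_split (pq 0%N) L1); last by move=> z; exact: mE.
rewrite (unit_law_split (pq' 0%N) L1'); last by move=> z; exact: mE.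
rewrite ge0_sume_distrr; last first.
  by move=> z _; rewrite mule_ge0// lee_fin; case: (pq' 0%N).
apply: lee_sum => z _; rewrite big_ord_recl expRD EFinM.
rewrite -muleA [X in (_ <= _ * X)%E]muleCA muleA -EFinM.
apply: lee_pmul => //; rewrite ?lee_fin; [by case: (pq 0%N)|exact: qe|].
apply: (IH (fun i => q i.+1) (fun i => q' i.+1) (fun i => e i.+1) (H' z)) => //.
by move=> i iM; exact: qM.
Qed.

Lemma digit_lt q K u : is_pmf q -> \sum_(z < K) q z = 1 -> (digit q u < K)%N.
Proof.
move=> pq K1; have [u01|u01] := boolP (0 <= u < 1); last first.
  rewrite digit_out// lt0n; apply/eqP => K0; move: K1; rewrite K0 big_ord0 => /eqP.
  by rewrite eq_sym oner_eq0.
rewrite ltnNge; apply/negP => /(cdf_mono pq); rewrite {1}/cdf K1 => h.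
case/andP: (digitP pq u01) => d1 _; case/andP: u01 => _ u1.
by have := lt_le_trans u1 (le_trans h d1); rewrite ltxx.
Qed.

Lemma draws_lt q m K u : (forall i, is_pmf (q i)) -> \sum_(z < K) q m z = 1 ->
  (draws q u m < K)%N.
Proof.
elim: m q u => [|m IH] q u pq K1 /=; first exact: digit_lt.
exact: (IH (fun i => q i.+1)).
Qed.

Lemma measurable_fun_draws q m (g : nat -> R) : (forall i, is_pmf (q i)) ->
  measurable_fun setT (fun u : measurableTypeR R => g (draws q u m)).
Proof.
move=> pq; apply: (@measurable_finitary_fun q m.+1 _ _ (fun s => g (s m))) => //.
by move=> s s' ss'; rewrite ss'.
Qed.

Lemma integral_draws q m K (g : nat -> R) : (forall i, is_pmf (q i)) ->
  (forall z, 0 <= g z) -> \sum_(z < K) q m z = 1 ->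
  (\int[unit_law]_u (g (draws q u m))%:E = (\sum_(z < K) q m z * g z)%:E)%E.
Proof.
move=> pq g0 K1.
pose D z : set (measurableTypeR R) := [set u | draws q u m = z].
have mD z : measurable (D z) by exact: measurable_draws.
transitivity (\int[unit_law]_u (\sum_(z < K) (g z)%:E * (\1_(D z) u)%:E))%E.
  apply: eq_integral => u _.
  have dK := draws_lt u pq K1.
  rewrite (bigD1 (Ordinal dK))//= big1 ?adde0; last first.
    move=> i iz; rewrite indicE memNset ?mule0// /D/= => di.
    by move: iz; rewrite -val_eqE/= di eqxx.
  by rewrite indicE mem_set ?mule1.
rewrite ge0_integral_sum//; last 2 first.
- move=> z; apply/measurable_EFinP; apply: measurable_funM; first exact: measurable_cst.
  exact: measurable_indic.
- by move=> z u _; rewrite mule_ge0// lee_fin.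
rewrite -sumEFin; apply: eq_bigr => z _.
rewrite ge0_integralZl//; last 2 first.
- by apply/measurable_EFinP; exact: measurable_indic.
- by rewrite lee_fin.
by rewrite integral_indic// setIT [X in (_ * X)%E](unit_law_draws m z pq) muleC EFinM.
Qed.

End Unit.

(** * The exponential mechanism on vectors of counts *)

Definition ndist (m n : nat) : nat := (m - n) + (n - m).

Lemma ndist_triangle m n p : (ndist m p <= ndist m n + ndist n p)%N.
Proof. rewrite /ndist; lia. Qed.

Lemma ndistC m n : ndist m n = ndist n m.
Proof. by rewrite /ndist addnC. Qed.

Section Noise.
Variable R : realType.

(** The value [y = c] belongs to both sides of [c], whence the extra [f 0]. *)
Lemma sum_ndist n c (f : nat -> R) : (c <= n)%N ->
  \sum_(y < n.+1) f (ndist y c) + f 0%N =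
  \sum_(i < c.+1) f i + \sum_(i < (n - c).+1) f i.
Proof.
move=> cn; have [m ->] : exists m, n = (c + m)%N by exists (n - c)%N; rewrite subnKC.
rewrite addKn -addnS.
rewrite big_split_ord/= [\sum_(i < c.+1) _]big_ord_recl/= (reindex_inj rev_ord_inj)/=.
rewrite (_ : \sum_(i < c) _ = \sum_(i < c) f (bump 0 i)); last first.
  by apply: eq_bigr => i _; congr f; rewrite /ndist /bump; have := ltn_ord i; lia.
rewrite (_ : \sum_(i < m.+1) f (ndist (c + i) c) = \sum_(i < m.+1) f i); last first.
  by apply: eq_bigr => i _; congr f; rewrite /ndist; lia.
by ring.
Qed.

(** A truncated geometric variable has a smaller mean than the full one. *)
Lemma geometric_mean_le (a : R) m : 0 <= a ->
  (1 - a) * (\sum_(i < m.+1) a ^+ i * i%:R) <= a * \sum_(i < m.+1) a ^+ i.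
Proof.
move=> a0.
suff -> : (1 - a) * (\sum_(i < m.+1) a ^+ i * i%:R) =
   a * (\sum_(i < m.+1) a ^+ i) - m.+1%:R * a ^+ m.+1.
  by rewrite lerBlDr lerDl mulr_ge0// exprn_ge0.
elim: m => [|m IH].
  by rewrite !big_ord_recr !big_ord0/= !add0r mulr0 mulr0 expr0 expr1; ring.
rewrite big_ord_recr/= mulrDr IH [in RHS]big_ord_recr/= !exprS -!natr1; ring.
Qed.

Lemma geometric_ndist (a : R) n c : 0 <= a < 1 -> (c <= n)%N ->
  \sum_(y < n.+1) a ^+ ndist y c * (ndist y c)%:R <=
  (2 * a / (1 - a)) * \sum_(y < n.+1) a ^+ ndist y c.
Proof.
move=> /andP[a0 a1] cn.
have := @sum_ndist n c (fun i => a ^+ i * i%:R) cn; rewrite mulr0 addr0 => ->.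
have E := @sum_ndist n c (fun i => a ^+ i) cn; rewrite expr0 in E.
have S1 m : 1 <= \sum_(i < m.+1) a ^+ i.
  by rewrite big_ord_recl expr0 lerDl sumr_ge0// => i _; rewrite exprn_ge0.
have T1 m := geometric_mean_le m a0.
have a1' : 0 < 1 - a by lra.
rewrite -(ler_pM2l a1').
have := S1 c; have := S1 (n - c)%N; have := T1 c; have := T1 (n - c)%N.
move: E; set Z := \sum_(y < n.+1) _; set A := \sum_(i < c.+1) _.
set B := \sum_(i < _.+1) _; set A' := \sum_(i < c.+1) _; set B' := \sum_(i < _.+1) _.
move=> E h1 h2 h3 h4.
have hA : a * A <= a * Z by apply: ler_wpM2l => //; lra.
have hB : a * B <= a * Z by apply: ler_wpM2l => //; lra.
have -> : (1 - a) * (2 * a / (1 - a) * Z) = 2 * (a * Z) by field; rewrite gt_eqF.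
rewrite mulrDr; lra.
Qed.

Section mechanism.
Variables (I : finType) (n : nat).
Implicit Types (c : I -> nat) (z : {ffun I -> 'I_n.+1}).

Definition weight (a : R) c z : R := \prod_i a ^+ ndist (z i) (c i).

(** The exponential mechanism for the [l1] distance to [c], with a base for which
    all constants are rational in [eta]: [1 + eta <= exp eta] serves privacy,
    and a geometric variable of ratio [1 / (1 + eta)] has mean [1 / eta]. *)
Definition noise (eta : R) c z : R :=
  weight (1 + eta)^-1 c z / \sum_(z' : {ffun I -> 'I_n.+1}) weight (1 + eta)^-1 c z'.

Lemma weight_gt0 a c z : 0 < a -> 0 < weight a c z.
Proof. by move=> a0; apply: prodr_gt0 => i _; rewrite exprn_gt0. Qed.

Lemma sum_weight_gt0 a c : 0 < a -> 0 < \sum_(z : {ffun I -> 'I_n.+1}) weight a c z.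
Proof.
move=> a0; rewrite (bigD1 [ffun=> ord0])//= ltr_pwDl ?weight_gt0//.
by apply: sumr_ge0 => z _; rewrite ltW// weight_gt0.
Qed.

Lemma weight_shift a c c' z : 0 < a <= 1 ->
  a ^+ (\sum_i ndist (c i) (c' i)) * weight a c z <= weight a c' z.
Proof.
move=> /andP[a0 a1]; rewrite expr_sum -big_split/=; apply: ler_prod => i _.
have a0' := ltW a0; rewrite mulr_ge0 ?exprn_ge0//= -exprD; apply: ler_wiXn2l => //.
by rewrite addnC ndist_triangle.
Qed.

Lemma noise_ge0 eta c z : 0 < eta -> 0 <= noise eta c z.
Proof.
by move=> e0; rewrite divr_ge0 ?ltW ?weight_gt0 ?sum_weight_gt0// invr_gt0; lra.
Qed.

Lemma noise_sum1 eta c : 0 < eta -> \sum_z noise eta c z = 1.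
Proof.
move=> e0; rewrite -mulr_suml divff// gt_eqF// sum_weight_gt0// invr_gt0; lra.
Qed.

(** The factor [2] accounts for the weight and for the normalizing sum. *)
Lemma noise_dp eta c c' z : 0 < eta ->
  noise eta c z <=
  expR (2 * eta * (\sum_i ndist (c i) (c' i))%N%:R) * noise eta c' z.
Proof.
move=> e0; set D := (\sum_i _)%N.
pose a := (1 + eta)^-1.
have a0 : 0 < a by rewrite invr_gt0; lra.
have a1 : a <= 1 by rewrite invf_le1; lra.
have aD : a ^+ D * expR (eta * D%:R) >= 1.
  rewrite [eta * _]mulrC expRM_natl -exprMn exprn_ege1// /a mulrC ler_pdivlMr; last lra.
  by rewrite mul1r expR_ge1Dx.
have w1 := weight_shift c c' z (introT andP (conj a0 a1)).
have w2 : a ^+ D * \sum_(z' : {ffun I -> 'I_n.+1}) weight a c' z' <=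
   \sum_(z' : {ffun I -> 'I_n.+1}) weight a c z'.
  rewrite mulr_sumr; apply: ler_sum => z' _.
  have <- : (\sum_i ndist (c' i) (c i) = D)%N by apply: eq_bigr => i _; rewrite ndistC.
  by apply: weight_shift; rewrite a0.
rewrite /noise -/a mulrA ler_pdivlMr ?sum_weight_gt0// mulrAC ler_pdivrMr ?sum_weight_gt0//.
have -> : expR (2 * eta * D%:R) = expR (eta * D%:R) * expR (eta * D%:R).
  by rewrite -expRD; congr expR; ring.
set X := expR _ in aD *; set w := weight a c z in w1 *; set w' := weight a c' z in w1 *.
set S' := \sum_z' _ in w2 *; set S := \sum_z' _ in w2 *.
have X0 : 0 <= X by exact: expR_ge0.
have wX : w <= X * w'.
  apply: (@le_trans _ _ (X * (a ^+ D * w))); last by rewrite ler_wpM2l.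
  by rewrite mulrA (mulrC X) ler_peMl// ltW// weight_gt0.
have SX : S' <= X * S.
  apply: (@le_trans _ _ (X * (a ^+ D * S'))); last by rewrite ler_wpM2l.
  by rewrite mulrA (mulrC X) ler_peMl// ltW// sum_weight_gt0.
rewrite [leRHS](_ : _ = (X * w') * (X * S)); last by ring.
apply: ler_pM => //.
  by rewrite ltW// weight_gt0.
by rewrite ltW// sum_weight_gt0.
Qed.

(** The weights are products over the coordinates, so the law of one coordinate is
    the one-dimensional mechanism, a two-sided truncated geometric law. *)
Lemma noise_err eta c i : 0 < eta -> (c i <= n)%N ->
  \sum_z noise eta c z * (ndist (z i) (c i))%:R <= 2 / eta.
Proof.
move=> e0 cn.
pose a := (1 + eta)^-1.
have a0 : 0 < a by rewrite invr_gt0; lra.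
have a1 : a < 1 by rewrite invf_lt1; lra.
have -> : 2 / eta = 2 * a / (1 - a).
  by rewrite /a; field; rewrite ?gt_eqF//; lra.
have S0 : 0 < \sum_(z' : {ffun I -> 'I_n.+1}) weight a c z' by rewrite sum_weight_gt0.
rewrite /noise -/a.
under eq_bigr do rewrite mulrAC.
rewrite -mulr_suml ler_pdivrMr//.
pose F (g : nat -> R) (j : I) (y : 'I_n.+1) : R :=
  a ^+ ndist y (c j) * (if j == i then g (ndist y (c j)) else 1).
have FE g : \sum_(z : {ffun I -> 'I_n.+1}) weight a c z * g (ndist (z i) (c i)) =
    (\sum_y F g i y) * \prod_(j | j != i) \sum_(y < n.+1) a ^+ ndist y (c j).
  transitivity (\sum_(z : {ffun I -> 'I_n.+1}) \prod_j F g j (z j)).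
    apply: eq_bigr => z _; rewrite [RHS]big_split/=; congr (_ * _).
    by rewrite (bigD1 i)//= eqxx big1 ?mulr1// => j /negbTE ->.
  rewrite -(bigA_distr_bigA (F g)) (bigD1 i)//=; congr (_ * _).
  by apply: eq_bigr => j /negbTE ji; apply: eq_bigr => y _; rewrite /F ji mulr1.
have F1 : \sum_(z : {ffun I -> 'I_n.+1}) weight a c z =
    (\sum_y F (fun=> 1) i y) * \prod_(j | j != i) \sum_(y < n.+1) a ^+ ndist y (c j).
  by rewrite -FE; apply: eq_bigr => z _; rewrite mulr1.
rewrite (FE (fun k => k%:R)) F1 mulrA; apply: ler_wpM2r.
  by apply: prodr_ge0 => j _; apply: sumr_ge0 => y _; rewrite exprn_ge0// ltW.
rewrite /F eqxx; under [X in _ <= _ * X]eq_bigr do rewrite mulr1.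
by apply: geometric_ndist => //; rewrite a1 ltW.
Qed.

End mechanism.
End Noise.

(** * Greedy matchings in a hierarchy of cells *)

Section Greedy.
Variables (T : eqType) (K : finType) (cell : nat -> T -> K).
Hypothesis cell0 : forall x y, cell 0 x = cell 0 y.
Hypothesis cell_nested : forall l x y, cell l.+1 x = cell l.+1 y -> cell l x = cell l y.

Definition cell_count l (s : seq T) (k : K) : nat := count (fun x => cell l x == k) s.

Definition discrepancy l (xs ys : seq T) : nat :=
  \sum_(k : K) ndist (cell_count l xs k) (cell_count l ys k).

Lemma cell_nested_le l m x y : (l <= m)%N -> cell m x = cell m y -> cell l x = cell l y.
Proof.
move=> lm; rewrite -(subnKC lm); elim: (m - l)%N => [|j IH]; first by rewrite addn0.
by rewrite addnS => /cell_nested.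
Qed.

Lemma perm_discrepancy l xs xs' ys ys' : perm_eq xs xs' -> perm_eq ys ys' ->
  discrepancy l xs ys = discrepancy l xs' ys'.
Proof.
move=> /permP px /permP py; apply: eq_bigr => k _.
by rewrite /cell_count px py.
Qed.

Lemma discrepancy_cons_same l x y xs ys : cell l x = cell l y ->
  discrepancy l (x :: xs) (y :: ys) = discrepancy l xs ys.
Proof.
move=> xy; apply: eq_bigr => k _; rewrite /cell_count/= xy /ndist; lia.
Qed.

Lemma discrepancy_cons_far l x y xs ys :
  {in x :: xs & y :: ys, forall x' y', cell l x' != cell l y'} ->
  discrepancy l (x :: xs) (y :: ys) = (discrepancy l xs ys).+2.
Proof.
move=> far.
have one k0 : (\sum_(k : K) (k0 == k) = 1)%N.
  by rewrite (bigD1 k0)//= eqxx big1 // => k /negbTE; rewrite eq_sym => ->.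
rewrite -addn2 -[2%N]/(1 + 1)%N -{1}(one (cell l x)) -(one (cell l y)) -!big_split/=.
apply: eq_bigr => k _; rewrite /cell_count/=.
have xy : cell l x != cell l y by apply: far; rewrite mem_head.
have hx : cell l x = k -> count (fun z => cell l z == k) ys = 0%N.
  move=> <-; apply/eqP; rewrite -leqn0 leqNgt -has_count; apply/hasPn => z zys.
  by rewrite eq_sym; apply: far; rewrite ?mem_head// inE zys orbT.
have hy : cell l y = k -> count (fun z => cell l z == k) xs = 0%N.
  move=> <-; apply/eqP; rewrite -leqn0 leqNgt -has_count; apply/hasPn => z zxs.
  by apply: far; rewrite ?mem_head// inE zxs orbT.
case: eqP => [xk|_]; case: eqP => [yk|_]; rewrite /ndist.
- by rewrite xk yk eqxx in xy.
- rewrite hx//; lia.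
- rewrite hy//; lia.
- lia.
Qed.

(** Remove a pair [(x, y)] that shares a cell at the deepest possible level [m].
    At the levels up to [m] the two points share a cell and the discrepancy does
    not change; beyond [m] no cell contains points of both lists, so that the
    discrepancy drops by exactly two, while the pair adds one to the count of
    separated pairs. *)
Lemma greedy_matching L xs ys : size xs = size ys ->
  exists ps : seq (T * T),
    [/\ perm_eq xs (unzip1 ps), perm_eq ys (unzip2 ps) &
        forall l, (l <= L)%N ->
          (2 * count (fun p => cell l p.1 != cell l p.2) ps <= discrepancy l xs ys)%N].
Proof.
move=> sxy; have [n xsn] : exists n, size xs = n by exists (size xs).
elim: n xs ys xsn sxy => [|n IH] xs ys xsn ysn.
  by case: xs ys xsn ysn => [|? ?] [|? ?] // _ _; exists [::].
pose P m := (m <= L)%N && has (fun x => has (fun y => cell m x == cell m y) ys) xs.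
have P0 : P 0%N.
  rewrite /P /=; clear P; case: xs ys xsn ysn => [|x xs] [|y ys] //= _ _.
  by rewrite (cell0 x y) eqxx.
have PL m : P m -> (m <= L)%N by case/andP.
have [m /andP[mL /hasP[x xin /hasP[y yin /eqP xy]]] mmax] :=
  ex_maxnP (ex_intro (fun m => is_true (P m)) 0%N P0) PL.
have px := perm_to_rem xin; have py := perm_to_rem yin.
have [||ps [px' py' cps]] := IH (rem x xs) (rem y ys).
- by rewrite size_rem// xsn.
- by rewrite !size_rem// ysn.
exists ((x, y) :: ps); split => /=.
- by rewrite (perm_trans px)// perm_cons.
- by rewrite (perm_trans py)// perm_cons.
move=> l lL; rewrite (perm_discrepancy l px py) mulnDr; have := cps l lL.
have [lm|ml] := leqP l m.
  rewrite (cell_nested_le lm xy) eqxx muln0 add0n discrepancy_cons_same//.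
  exact: cell_nested_le xy.
have far : {in xs & ys, forall x' y', cell l x' != cell l y'}.
  move=> x' y' x'in y'in; apply/negP => e.
  have /mmax : P l by rewrite /P lL; apply/hasP; exists x' => //; apply/hasP; exists y'.
  by rewrite leqNgt ml.
rewrite discrepancy_cons_far; last first.
  by move=> x' y'; rewrite -(perm_mem px) -(perm_mem py); exact: far.
by rewrite far// muln1 -addn2 addnC leq_add2r.
Qed.

Section cost.
Variables (R : realType) (dist : T -> T -> R) (L : nat).
Hypothesis dist_cell : forall l x y, (l <= L)%N ->
  cell l x = cell l y -> dist x y <= 2^-1 ^+ l.

(** If [x] and [y] are separated from level [m + 1] on, the sum telescopes to
    [2^-m]. *)
Lemma dist_le_levels M x y : (M <= L)%N ->
  dist x y <= 2^-1 ^+ M + \sum_(l < M) 2^-1 ^+ l.+1 * (cell l.+1 x != cell l.+1 y)%:R.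
Proof.
elim: M => [|M IH] ML; first by rewrite big_ord0 addr0 dist_cell.
rewrite big_ord_recr/=; have [e|_] := eqVneq.
  by rewrite mulr0 addr0 (le_trans (dist_cell ML e))// lerDl sumr_ge0.
(* The separation at level [M + 1] pays for halving the first term. *)
have E : (2^-1 : R) ^+ M = 2^-1 ^+ M.+1 + 2^-1 ^+ M.+1 by rewrite exprS; field.
by rewrite (le_trans (IH (ltnW ML)))// mulr1 {1}E; lra.
Qed.

Lemma matching_cost xs ys : size xs = size ys ->
  exists ps : seq (T * T),
    [/\ perm_eq xs (unzip1 ps), perm_eq ys (unzip2 ps) &
     \sum_(p <- ps) dist p.1 p.2 <= (size xs)%:R * 2^-1 ^+ L +
       2^-1 * \sum_(l < L) 2^-1 ^+ l.+1 * (discrepancy l.+1 xs ys)%:R].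
Proof.
move=> sxy; have [ps [px py cps]] := greedy_matching L sxy.
exists ps; split => //.
apply: (@le_trans _ _ (\sum_(p <- ps) (2^-1 ^+ L +
    \sum_(l < L) 2^-1 ^+ l.+1 * (cell l.+1 p.1 != cell l.+1 p.2)%:R))).
  by apply: ler_sum => p _; exact: dist_le_levels.
rewrite big_split/= big_const_seq count_predT iter_addr_0 -[X in X + _ <= _]mulr_natl.
rewrite (perm_size px) size_map lerD2l exchange_big/= mulr_sumr.
apply: ler_sum => l _; rewrite -mulr_sumr mulrCA; apply: ler_wpM2l => //.
have := cps l.+1 (ltn_ord l); rewrite -(ler_nat R) natrM => h.
rewrite -sum1_count big_mkcond natr_sum in h.
rewrite (eq_bigr (fun p => ((if cell l.+1 p.1 != cell l.+1 p.2 then 1 else 0)%N%:R))) => [|p _].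
  lra.
by case: ifP.
Qed.

End cost.
End Greedy.

(** * Matchings bound the Wasserstein distance *)

Section UpperIntegral.
Context d (T : measurableType d) (R : realType).
Variable mu : {measure set T -> \bar R}.
Import HBNNSimple.

(** The integral of a nonnegative function is the supremum over its simple
    minorants, so an upper bound can be checked on them.  This serves for the
    metric on the product of two cubes, and for [W1], an infimum over uncountably
    many couplings, as a function of the seed. *)
Lemma integral_le_simple (f : T -> \bar R) (c : \bar R) :
  (forall x, 0 <= f x)%E ->
  (forall h : {nnsfun T >-> R}, (forall x, (h x)%:E <= f x)%E ->
     (\int[mu]_x (h x)%:E <= c)%E) ->
  (\int[mu]_x f x <= c)%E.
Proof.
move=> f0 fc; rewrite ge0_integralTE//; apply: ge_ereal_sup => _ [h hf <-].
by rewrite -integralT_nnsfun; exact: fc.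
Qed.

Lemma le_upper_integral (f g : T -> \bar R) : (forall x, 0 <= f x)%E ->
  measurable_fun setT g -> (forall x, f x <= g x)%E ->
  (\int[mu]_x f x <= \int[mu]_x g x)%E.
Proof.
move=> f0 mg fg; apply: integral_le_simple => // h hf.
apply: ge0_le_integral => //.
- by move=> x _; rewrite lee_fin.
- by apply/measurable_EFinP.
- by move=> x _; exact: le_trans (hf x) (fg x).
Qed.

End UpperIntegral.

Section Matching.
Variables (R : realType) (d : nat).
Local Notation X := (cube R d).

(** The uniform law on the pairs of a matching.  The size is written [t.+1] so that
    the law has mass one for every [t]. *)
Definition matching_law t (ps : seq (X * X)) : set (X * X) -> \bar R :=
  mscale (t.+1%:R^-1)%:nng (msum (fun i => dirac (nth point ps i)) t.+1).

HB.instance Definition _ t ps := Measure.on (@matching_law t ps).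

Lemma matching_lawT t ps : @matching_law t ps setT = 1%E.
Proof.
rewrite /matching_law /mscale/= /msum. rewrite (eq_bigr (fun=> 1%:E)) => [|i _]; last exact: diracT.
by rewrite sumEFin big_const_ord iter_addr_0 -EFinM mulVf// pnatr_eq0.
Qed.

HB.instance Definition _ t ps :=
  Measure_isProbability.Build _ _ _ (@matching_law t ps) (@matching_lawT t ps).

Lemma empiricalE t (xs : t.-tuple X) (A : set X) :
  empirical xs A = ((t%:R^-1)%:E * \sum_(x <- xs) (\1_A x)%:E)%E.
Proof.
rewrite /empirical /mscale/= /msum/=; congr (_ * _)%E.
by rewrite (big_nth point) size_tuple big_mkord.
Qed.

Lemma matching_lawE t ps (A : set (X * X)) : size ps = t.+1 ->
  matching_law t ps A = ((t.+1%:R^-1)%:E * \sum_(p <- ps) (\1_A p)%:E)%E.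
Proof.
move=> pst; rewrite /matching_law /mscale/= /msum/=; congr (_ * _)%E.
by rewrite (big_nth point) pst big_mkord.
Qed.

Import HBNNSimple.

Lemma integral_matching t ps (h : {nnsfun (X * X)%type >-> R}) : size ps = t.+1 ->
  (\int[matching_law t ps]_p (h p)%:E =
   ((t.+1%:R^-1) * \sum_(p <- ps) h p)%:E)%E.
Proof.
move=> pst; rewrite /matching_law ge0_integral_mscale//; last 2 first.
- exact/measurable_EFinP.
- by move=> p _; rewrite lee_fin.
rewrite ge0_integral_measure_sum//; last 2 first.
- by move=> p _; rewrite lee_fin.
- exact/measurable_EFinP.
rewrite EFinM; congr (_ * _)%E.
rewrite (eq_bigr (fun i : 'I_t.+1 => (h (nth point ps i))%:E)) => [|i _].

  by rewrite sumEFin (big_nth point) pst big_mkord.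
rewrite integral_dirac//; last exact/measurable_EFinP.
by rewrite [X in (X * _)%E](_ : _ = 1%E) ?mul1e//; exact: diracT.
Qed.

Lemma W1_matching t (xs ys : t.-tuple X) (ps : seq (X * X)) :
  (0 < t)%N -> perm_eq xs (unzip1 ps) -> perm_eq ys (unzip2 ps) ->
  (W1 (empirical xs) (empirical ys) <=
   (t%:R^-1 * \sum_(p <- ps) rho p.1 p.2)%:E)%E.
Proof.
case: t xs ys => // t xs ys _ px py.
have pst : size ps = t.+1 by rewrite -(size_tuple xs) (perm_size px) size_map.
apply: (@le_trans _ _ (\int[matching_law t ps]_z (rho z.1 z.2)%:E)%E).
  apply: ereal_inf_lbound.
  exists (matching_law t ps) => //= A mA; split.
  - transitivity (((t.+1%:R : R)^-1)%:E * \sum_(p <- ps) (\1_(fst @^-1` A) p : R)%:E)%E.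
      exact: matching_lawE.
    rewrite empiricalE (perm_big _ px)/= big_map.
    by congr (_ * _)%E; apply: eq_bigr => p _; rewrite !indicE.
  - transitivity (((t.+1%:R : R)^-1)%:E * \sum_(p <- ps) (\1_(snd @^-1` A) p : R)%:E)%E.
      exact: matching_lawE.
    rewrite empiricalE (perm_big _ py)/= big_map.
    by congr (_ * _)%E; apply: eq_bigr => p _; rewrite !indicE.
apply: integral_le_simple => [p|h hrho]; first by rewrite lee_fin normr_ge0.
rewrite integral_matching// lee_fin; apply: ler_wpM2l; first by rewrite invr_ge0.
by apply: ler_sum => p _; have := hrho p; rewrite lee_fin.
Qed.

Lemma W1_ge0 mu nu : (0 <= @W1 R d mu nu)%E.
Proof.
apply: le_ereal_inf_tmp => _ [g _ <-]; apply: integral_ge0 => p _.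
by rewrite lee_fin normr_ge0.
Qed.

End Matching.

(** * Dyadic cells and synthetic blocks *)

Section Cells.
Variables (R : realType) (d : nat).
Local Notation X := (cube R d).

Lemma cube_coord (x : X) j : 0 <= val x ord0 j <= 1.
Proof. by have := set_mem (valP x); exact. Qed.

Lemma minn_truncn_bounds (N : nat) (y : R) : (0 < N)%N -> 0 <= y <= N%:R ->
  (minn (Num.truncn y) N.-1)%:R <= y <= (minn (Num.truncn y) N.-1).+1%:R.
Proof.
move=> N0 /andP[y0 yN]; have /andP[t0 t1] := truncn_itv y0.
have [h|h] := leqP (Num.truncn y) N.-1; first by rewrite t0 ltW.
by rewrite prednK// yN andbT (le_trans _ t0)// ler_nat ltnW.
Qed.

Section depth.
Variable L : nat.

Definition grid : finType := {ffun 'I_d -> 'I_(2 ^ L)}.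

Lemma grid_index_subproof (m : nat) : (minn m (2 ^ L).-1 < 2 ^ L)%N.
Proof. by have := expn_gt0 2 L; lia. Qed.

(** The minimum sends the right end of the unit interval to the last cell. *)
Definition leaf (x : X) : grid :=
  [ffun j => Ordinal (grid_index_subproof (Num.truncn (2 ^+ L * val x ord0 j)))].

Lemma leafE x j : leaf x j = minn (Num.truncn (2 ^+ L * val x ord0 j)) (2 ^ L).-1 :> nat.
Proof. by rewrite ffunE. Qed.

Lemma leaf_bounds x j :
  (leaf x j)%:R <= 2 ^+ L * val x ord0 j <= (leaf x j).+1%:R.
Proof.
have /andP[x0 x1] := cube_coord x j.
rewrite leafE; apply: minn_truncn_bounds; first exact: expn_gt0.
have h0 : 0 <= (2 : R) ^+ L by rewrite exprn_ge0.
by apply/andP; split; [exact: mulr_ge0|rewrite natrX; exact: ler_piMr].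
Qed.

Lemma coarsen_subproof l (k : 'I_(2 ^ L)) : (k %/ 2 ^ (L - l) < 2 ^ L)%N.
Proof. exact: leq_ltn_trans (leq_div _ _) (ltn_ord k). Qed.

(** The cells of all levels are indexed in the same type, level [l] by vectors with
    entries below [2^l]; dividing the index of the leaf makes the levels nested. *)
Definition cell l (x : X) : grid :=
  [ffun j => Ordinal (coarsen_subproof l (leaf x j))].

Lemma cellE l x j : cell l x j = (leaf x j %/ 2 ^ (L - l))%N :> nat.
Proof. by rewrite ffunE. Qed.

Lemma cell0 x y : cell 0 x = cell 0 y.
Proof.
apply/ffunP => j; apply/val_inj; rewrite [LHS]cellE [RHS]cellE.
by rewrite subn0 !divn_small//; exact: ltn_ord.
Qed.

Lemma cell_nested l x y : cell l.+1 x = cell l.+1 y -> cell l x = cell l y.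
Proof.
move=> /ffunP h; apply/ffunP => j; apply/val_inj; rewrite [LHS]cellE [RHS]cellE.
have /(congr1 (@nat_of_ord _)) := h j; rewrite !cellE => {}h.
have [lL|Ll] := ltnP l L; last first.
  by move: h; rewrite (eqP Ll) (eqP (leqW Ll : (L <= l.+1)%N)).
rewrite (_ : L - l = (L - l.+1) + 1)%N; last lia.
by rewrite expnD !divnMA h.
Qed.

Lemma rho_cell l x y : (l <= L)%N -> cell l x = cell l y -> rho x y <= 2^-1 ^+ l.
Proof.
move=> lL /ffunP h; rewrite /rho {1}/Num.norm/= mx_normrE.
apply: bigmax_le; first by rewrite exprn_ge0.
move=> [i j] _ /=; rewrite !mxE (ord1 i).
have /(congr1 (@nat_of_ord _)) := h j; rewrite !cellE => {}h.
have := leaf_bounds x j; have := leaf_bounds y j.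
set a := leaf x j in h *; set b := leaf y j in h *.
set u := val x ord0 j; set v := val y ord0 j.
have P (k : nat) (w : R) : k%:R <= 2 ^+ L * w <= k.+1%:R ->
    (k %/ 2 ^ (L - l))%:R <= 2 ^+ l * w <= (k %/ 2 ^ (L - l)).+1%:R.
  have N0 : 0 < 2 ^+ (L - l) :> R by rewrite exprn_gt0.
  have -> : (2 : R) ^+ L = 2 ^+ (L - l) * 2 ^+ l by rewrite -exprD subnK.
  move=> /andP[k1 k2]; apply/andP; split.
    rewrite -(ler_pM2l N0) mulrA (le_trans _ k1)// -natrX -natrM ler_nat mulnC leq_divM//.
  rewrite -(ler_pM2l N0) mulrA (le_trans k2)// -natrX -natrM ler_nat mulnC ltn_ceil//.
  by rewrite expn_gt0.
move=> /P /andP[v1 v2] /P /andP[u1 u2]; rewrite -h in v1 v2.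
have l0 : 0 < 2 ^+ l :> R by rewrite exprn_gt0.
rewrite exprVn -[leRHS]mul1r ler_pdivlMr// -(gtr0_norm l0) -normrM.
move: u1 u2 v1 v2; rewrite -natr1 => u1 u2 v1 v2.
rewrite ler_norml mulrBl !(mulrC _ (2 ^+ l)); apply/andP; split; lra.
Qed.

Definition cells l : {pred grid} := ffun_on [pred m : 'I_(2 ^ L) | (m < 2 ^ l)%N].

Lemma cell_cells l x : (l <= L)%N -> cell l x \in cells l.
Proof.
move=> lL; apply/ffun_onP => j; rewrite inE /= cellE ltn_divLR ?expn_gt0//.
by rewrite -expnD subnKC.
Qed.

Lemma card_cells l : (l <= L)%N -> #|cells l| = ((2 ^ l) ^ d)%N.
Proof.
move=> lL; rewrite card_ffun_on card_ord; congr (_ ^ _)%N.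
have lL2 : (2 ^ l <= 2 ^ L)%N by rewrite leq_exp2l.
by rewrite -sum1_card (big_ord_narrow lL2) sum1_card card_ord.
Qed.

Lemma corner_subproof (k : grid) :
  (\row_j ((k j)%:R / 2 ^+ L) : 'rV[R]_d) \in
  [set x : 'rV[R]_d | forall i, 0 <= x ord0 i <= 1].
Proof.
rewrite inE /= => j; rewrite mxE divr_ge0 ?exprn_ge0//=.
by rewrite ler_pdivrMr ?exprn_gt0// mul1r -natrX ler_nat ltnW.
Qed.

Definition corner (k : grid) : X :=
  exist (fun x => x \in [set x : 'rV[R]_d | forall i, 0 <= x ord0 i <= 1]) _
    (corner_subproof k).

Lemma leaf_corner k : leaf (corner k) = k.
Proof.
apply/ffunP => j; apply/val_inj => /=; rewrite leafE /= mxE.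
rewrite mulrC divfK ?expf_neq0// natrK; apply/minn_idPl.
by rewrite -ltnS prednK ?expn_gt0.
Qed.

Lemma cell_corner_leaf l x : cell l (corner (leaf x)) = cell l x.
Proof. by apply/ffunP => j; apply/val_inj; rewrite [LHS]cellE [RHS]cellE leaf_corner. Qed.

End depth.

Section block.
Variables n L : nat.

(** The query [(l, k)] counts the points in cell [k] of level [l + 1]; the number of
    points at level [0] is public. *)
Definition query : finType := ('I_L * grid L)%type.

Lemma sum_query (F : query -> R) :
  \sum_(j : query | j.2 \in @cells L j.1.+1) F j =
  \sum_(l < L) \sum_(k in @cells L l.+1) F (l, k).
Proof. by rewrite pair_big_dep; apply: eq_bigr => -[]. Qed.

Definition reply : finType := {ffun query -> 'I_n.+1}.

Definition block_count (xs : seq X) (j : query) : nat :=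
  cell_count (@cell L) j.1.+1 xs j.2.

(** The weight of a level is what a separation at that level adds to the distance of
    two points in [dist_le_levels]. *)
Definition score (xs : seq X) (z : reply) : R :=
  \sum_(j : query | j.2 \in @cells L j.1.+1)
     2^-1 ^+ j.1.+1 * (ndist (block_count xs j) (z j))%:R.

Definition grid_point (ks : n.-tuple (grid L)) : seq X := map (@corner L) ks.

Definition grid0 : grid L := [ffun=> Ordinal (grid_index_subproof L 0)].

(** Perturbed counts need not be the counts of any dataset; fitting a dataset of
    [n] grid points to them restores consistency and the exact size. *)
Definition fit (z : reply) : seq X :=
  grid_point [arg min_(ks < [tuple of nseq n grid0]) score (grid_point ks) z]%O.

Lemma size_fit z : size (fit z) = n.
Proof. by rewrite /fit /grid_point size_map size_tuple. Qed.

(** Rounding the data to the grid changes none of its counts, so the rounded data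
    compete in the minimization. *)
Lemma fit_optimal (xs : seq X) z : size xs = n -> score (fit z) z <= score xs z.
Proof.
move=> xsn; rewrite /fit; case: arg_minP => //= ks _ ksmin.
have szt : size (map (@leaf L) xs) == n by rewrite size_map xsn.
apply: (le_trans (ksmin (Tuple szt) isT)).
rewrite le_eqVlt; apply/orP; left; apply/eqP; rewrite /score; apply: eq_bigr => j _.
congr (_ * _%:R); congr ndist.
rewrite /block_count /cell_count /grid_point/= !count_map.
by apply: eq_count => x /=; rewrite cell_corner_leaf.
Qed.

(** By the triangle inequality the discrepancy of [xs] and the fit is at most the
    sum of their scores, and the fit has the smaller score. *)
Lemma fit_matching (xs : seq X) z : size xs = n ->
  exists ps : seq (X * X),
    [/\ perm_eq xs (unzip1 ps), perm_eq (fit z) (unzip2 ps) &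
     \sum_(p <- ps) rho p.1 p.2 <= n%:R * 2^-1 ^+ L + score xs z].
Proof.
move=> xsn; have sz : size xs = size (fit z) by rewrite size_fit.
have [ps [px py cps]] := @matching_cost _ _ (@cell L) (@cell0 L) (@cell_nested L)
  _ (@rho R d) L (@rho_cell L) _ _ sz.
exists ps; split => //; apply: (le_trans cps); rewrite xsn lerD2l.
have -> : score xs z = 2^-1 * (score xs z + score xs z) by field.
apply: ler_wpM2l => //.
apply: (@le_trans _ _ (score xs z + score (fit z) z)); last by rewrite lerD2l fit_optimal.
rewrite /score -big_split/= sum_query/=.
apply: ler_sum => l _.
rewrite /discrepancy natr_sum mulr_sumr [leRHS]big_mkcond/=; apply: ler_sum => k _.
case: ifPn => [_|kN].
  rewrite -mulrDr; apply: ler_wpM2l; first by rewrite exprn_ge0.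
  by rewrite -natrD ler_nat (ndistC (block_count (fit z) _)) ndist_triangle.
(* Indices outside [cells] count no point of either list. *)
have c0 s : cell_count (@cell L) l.+1 s k = 0%N.
  apply/eqP; rewrite -leqn0 leqNgt -has_count; apply/hasPn => x _.
  by apply: contra kN => /eqP <-; exact: cell_cells.
by rewrite !c0 mulr0.
Qed.

Lemma expected_score (xs : seq X) eta : 0 < eta -> size xs = n ->
  \sum_(z : reply) noise eta (block_count xs) z * score xs z <=
  2 / eta * \sum_(l < L) 2^-1 ^+ l.+1 * (2 ^+ l.+1) ^+ d.
Proof.
move=> e0 xsn.
have -> : \sum_(z : reply) noise eta (block_count xs) z * score xs z =
  \sum_(j : query | j.2 \in @cells L j.1.+1)
     2^-1 ^+ j.1.+1 * \sum_(z : reply) noise eta (block_count xs) z * (ndist (z j) (block_count xs j))%:R.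
  under eq_bigr do rewrite mulr_sumr.
  rewrite exchange_big/=; apply: eq_bigr => j _; rewrite mulr_sumr; apply: eq_bigr => z _.
  by rewrite mulrCA ndistC.
apply: (@le_trans _ _ (\sum_(j : query | j.2 \in @cells L j.1.+1) 2^-1 ^+ j.1.+1 * (2 / eta))).
  apply: ler_sum => j _; apply: ler_wpM2l; first by rewrite exprn_ge0.
  by apply: noise_err => //; rewrite /block_count /cell_count -xsn count_size.
rewrite sum_query/= mulr_sumr.
apply: ler_sum => l _; rewrite big_const iter_addr_0 card_cells//.
by rewrite -[leLHS]mulr_natl !natrX le_eqVlt; apply/orP; left; apply/eqP; ring.
Qed.

(** At each level, the changed point leaves one cell and enters another. *)
Lemma block_count_sensitivity (I : seq nat) (x x' : nat -> X) k : uniq I ->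
  (forall i, i != k -> x i = x' i) ->
  (\sum_(j : query) ndist (block_count (map x I) j) (block_count (map x' I) j) <=
   2 * L * (k \in I))%N.
Proof.
move=> uI xk.
rewrite (_ : (\sum_(j : query) _)%N = \sum_(l < L) \sum_(g : grid L)
    ndist (block_count (map x I) (l, g)) (block_count (map x' I) (l, g)))%N; last first.
  by rewrite pair_big; apply: eq_bigr => -[].
have one l : (\sum_(g : grid L) ndist (block_count (map x I) (l, g))
   (block_count (map x' I) (l, g)) <= 2 * (k \in I))%N.
  apply: (@leq_trans (\sum_(g : grid L) \sum_(i <- I)
     ndist (cell L l.+1 (x i) == g) (cell L l.+1 (x' i) == g))).
    apply: leq_sum => g _; rewrite /block_count /cell_count/= !count_map.
    elim: (I) => [|i J IH]; first by rewrite big_nil.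
    by rewrite big_cons /=; move: IH; rewrite /ndist; lia.
  rewrite exchange_big/=.
  have [kI|kI] := boolP (k \in I); last first.
    rewrite big_seq big1// => i iI; rewrite xk; last by apply: contraNneq kI => <-.
    by apply: big1 => g _; rewrite /ndist subnn.
  rewrite (big_rem k)//= [X in (_ + X)%N]big_seq [X in (_ + X)%N]big1 ?addn0; last first.
    move=> i; rewrite mem_rem_uniq// inE => /andP[ik _]; rewrite xk//.
    by apply: big1 => g _; rewrite /ndist subnn.
  apply: (@leq_trans (\sum_(g : grid L) ((cell L l.+1 (x k) == g) + (cell L l.+1 (x' k) == g)))).
    by apply: leq_sum => g _; rewrite /ndist; lia.
  have s1 (g0 : grid L) : (\sum_(g : grid L) (g0 == g) = 1)%N.
    by rewrite (bigD1 g0)//= eqxx big1 // => g /negbTE; rewrite eq_sym => ->.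
  by rewrite big_split/= !s1.
apply: (@leq_trans (\sum_(l < L) 2 * (k \in I))); first by apply: leq_sum => l _; exact: one.
by rewrite sum_nat_const card_ord; nia.
Qed.

End block.
End Cells.

(** * Dyadic blocks of time *)

Section Blocks.

(** Epoch [k] consists of the times [t >= 2] with [2^k < t <= 2^(k+1)].  Time [1] has
    epoch and level [0], by the values of [trunc_log] and [logn] at [0], which makes
    its block the first point alone. *)
Definition epoch (t : nat) : nat := trunc_log 2 t.-1.

(** The block that ends at [t] is that of a Fenwick tree for the epoch: its size is
    the largest power of two dividing the position of [t] in the epoch. *)
Definition level (t : nat) : nat := logn 2 (t - 2 ^ epoch t).

Definition bsize (t : nat) : nat := 2 ^ level t.

Definition bstart (t : nat) : nat := t - bsize t.

Lemma epoch_bounds t : (1 < t)%N -> (2 ^ epoch t < t <= 2 ^ (epoch t).+1)%N.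
Proof.
move=> t1; have t1' : (0 < t.-1)%N by lia.
by have := @trunc_log_bounds 2 _ isT t1'; rewrite /epoch; lia.
Qed.

Lemma bsize_le t : (1 < t)%N -> (bsize t <= t - 2 ^ epoch t)%N.
Proof.
move=> t1; have := epoch_bounds t1 => /andP[e1 _].
by apply: dvdn_leq; [lia|exact: pfactor_dvdnn].
Qed.

Lemma bsize_gt0 t : (0 < bsize t)%N. Proof. by rewrite expn_gt0. Qed.

Lemma level1 : level 1 = 0%N. Proof. by []. Qed.

Lemma bstart1 : bstart 1 = 0%N. Proof. by []. Qed.

Lemma bstart_ge t : (1 < t)%N -> (2 ^ epoch t <= bstart t)%N.
Proof.
by move=> t1; have := bsize_le t1; have := epoch_bounds t1; rewrite /bstart; lia.
Qed.

Lemma bstart_lt t : (0 < t)%N -> (bstart t < t)%N.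
Proof. by move=> t0; have := bsize_gt0 t; rewrite /bstart; lia. Qed.

Lemma bstartK t : (0 < t)%N -> (bstart t + bsize t = t)%N.
Proof.
case: t => [//|[|t]] _; first by [].
by have := @bsize_le t.+2 isT; rewrite /bstart; lia.
Qed.

Lemma level_le_epoch t : (level t <= epoch t)%N.
Proof.
case: t => [|[|t]]; [by []|by []|].
have := @bsize_le t.+2 isT; have := @epoch_bounds t.+2 isT; rewrite expnS => h1 h2.
have : (2 ^ level t.+2 <= 2 ^ epoch t.+2)%N by move: h2; rewrite /bsize; lia.
by rewrite leq_exp2l.
Qed.

Lemma epoch_le t t' : (t <= t')%N -> (epoch t <= epoch t')%N.
Proof. by move=> tt'; apply: leq_trunc_log; lia. Qed.

Definition covers (i t : nat) : bool := (bstart t <= i < t)%N.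

Lemma covers_epoch i t : covers i t -> epoch t = trunc_log 2 i.
Proof.
case: t => [|[|t]]; rewrite /covers; first by rewrite ltn0 andbF.
  by rewrite bstart1 => /andP[_]; case: i.
move=> /andP[bi it]; apply/esym; apply: trunc_log_eq => //.
by have := @bstart_ge t.+2 isT; have := @epoch_bounds t.+2 isT; lia.
Qed.

(** The blocks of one level in an epoch are aligned at multiples of their size,
    hence disjoint. *)
Lemma covers_inj i t t' : covers i t -> covers i t' -> level t = level t' -> t = t'.
Proof.
move=> ci ci' l; have e := covers_epoch ci; have e' := covers_epoch ci'.
have [i0|i0] := posnP i.
  suff h s : covers i s -> s = 1%N by rewrite (h t)// (h t').
  rewrite i0 /covers; case: s => [|[|s]] //.
  by move=> /andP[+ _]; have := @bstart_ge s.+2 isT; have := expn_gt0 2 (epoch s.+2); lia.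
(* The end of the block is determined by the point and the level. *)
have h s : covers i s -> (s - 2 ^ trunc_log 2 i =
    ((i - 2 ^ trunc_log 2 i) %/ 2 ^ level s).+1 * 2 ^ level s)%N /\ (2 ^ trunc_log 2 i < s)%N.
  move=> cs; have es := covers_epoch cs.
  have s1 : (1 < s)%N by move: cs; rewrite /covers; lia.
  have := bsize_le s1; have := epoch_bounds s1; have := bstart_ge s1.
  move: cs; rewrite /covers /bstart -es => /andP[]; set E := (2 ^ epoch s)%N.
  have /dvdnP[a sa] : (2 ^ level s %| s - E)%N by exact: pfactor_dvdnn.
  rewrite /bsize; move: sa; set B := (2 ^ level s)%N => sa.
  have B0 : (0 < B)%N by rewrite expn_gt0.
  move=> h1 h2 h3 h4 h5; split; last by lia.
  rewrite sa; congr (_ * _)%N.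
  have a0 : (0 < a)%N by rewrite lt0n; apply/eqP => a0; rewrite a0 in sa; lia.
  have aE : (a * B = a.-1 * B + B)%N by rewrite -{1}(prednK a0) mulSn addnC.
  suff -> : ((i - E) %/ B = a.-1)%N by rewrite prednK.
  apply/eqP; rewrite eqn_leq; apply/andP; split.
    by rewrite -ltnS prednK// ltn_divLR//; lia.
  by rewrite leq_divRL//; lia.
have [ht ht1] := h _ ci; have [ht' ht1'] := h _ ci'.
by rewrite -l in ht'; lia.
Qed.

Lemma sum_covers M i : (\sum_(m < M) covers i m.+1 <= (trunc_log 2 i).+1)%N.
Proof.
rewrite -(big_mkord xpredT (fun m => nat_of_bool (covers i m.+1))) /index_iota subn0.
rewrite (eq_bigr (fun m => if covers i m.+1 then 1 else 0)%N) => [|m _]; last by case: ifP.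
rewrite -big_mkcond/= sum1_count -size_filter.
set s := [seq m <- iota 0 M | covers i m.+1].
have /uniq_leq_size : uniq [seq level m.+1 | m <- s].
  rewrite map_inj_in_uniq ?filter_uniq ?iota_uniq// => m m'.
  rewrite !mem_filter => /andP[/= cm _] /andP[/= cm' _] /(covers_inj cm cm').
  by case.
move=> /(_ (iota 0 (trunc_log 2 i).+1)); rewrite size_map size_iota; apply.
move=> y /mapP[m]; rewrite mem_filter => /andP[cm _] ->.
by rewrite mem_iota add0n ltnS -(covers_epoch cm) level_le_epoch.
Qed.

(** The ends of the blocks that make up the prefix of length [t]; [f] is fuel. *)
Fixpoint chain_rec (f t : nat) : seq nat :=
  if f is f'.+1 then
    if t is 0 then [::] else rcons (chain_rec f' (bstart t)) t
  else [::].

Definition chain (t : nat) : seq nat := chain_rec t t.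

Lemma chain_recE f t : (t <= f)%N -> chain_rec f t = chain t.
Proof.
rewrite /chain; elim: f {-2}f (leqnn f) t => [|n IH] [|f] fn [|t] //= tf.
have h := @bstart_lt t.+1 isT.
rewrite (IH f _ (bstart t.+1)); [|lia|lia].
by rewrite (IH t _ (bstart t.+1)); [|lia|lia].
Qed.

Lemma chainE t : (0 < t)%N -> chain t = rcons (chain (bstart t)) t.
Proof.
case: t => // t _; rewrite {1}/chain /= chain_recE//.
by have := @bstart_lt t.+1 isT; lia.
Qed.

Lemma chain_ind (P : nat -> Prop) :
  P 0%N -> (forall t, (0 < t)%N -> P (bstart t) -> P t) -> forall t, P t.
Proof.
move=> P0 PS t; elim: t {-2}t (leqnn t) => [|n IH] [|t] // tn.
by apply: PS => //; apply: IH; have := @bstart_lt t.+1 isT; lia.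
Qed.

Lemma chain_le t b : b \in chain t -> (0 < b <= t)%N.
Proof.
elim/chain_ind: t b => // t t0 IH b.
rewrite chainE// mem_rcons inE => /predU1P[->|/IH]; first by rewrite t0 leqnn.
by have := bstart_lt t0; lia.
Qed.

Lemma flatten_chain t : flatten [seq iota (bstart b) (bsize b) | b <- chain t] = iota 0 t.
Proof.
elim/chain_ind: t => // t t0 IH; rewrite chainE// map_rcons flatten_rcons IH.
by rewrite -[in RHS](bstartK t0) iotaD add0n.
Qed.

Lemma epochX k : epoch (2 ^ k.+1) = k.
Proof.
rewrite /epoch; apply: trunc_log_eq => //; have := expn_gt0 2 k; rewrite expnS; lia.
Qed.

(** Inside an epoch the levels strictly increase along the chain, since removing
    the lowest binary digit leaves a multiple of a higher power of two.  From the
    start of the epoch on, the chain runs through the preceding epochs as whole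
    blocks, down to the block of time [1]. *)
Lemma sum_chain (R : realType) (g : nat -> R) t : (forall j, 0 <= g j) -> (0 < t)%N ->
  \sum_(b <- chain t) g (level b) <=
  \sum_(level t <= j < (epoch t).+1) g j + \sum_(j < epoch t) g j + g 0%N.
Proof.
move=> g0; elim/chain_ind: t => // t t0 IH _.
have [t1|t1] := leqP t 1.
  have -> : t = 1%N by lia.
  by rewrite /= big_seq1 level1 /epoch big_nat1 big_ord0 addr0 lerDl.
(* The chain of time [2] is [1, 2], both of level [0]; the bound for time [1]
   counts level [0] twice and is too weak to continue from. *)
have [->|t2] := eqVneq t 2%N.
  have -> : chain 2 = [:: 1%N; 2%N] by [].
  rewrite big_cons big_seq1 level1 (_ : level 2 = 0%N)// (_ : epoch 2 = 0%N)//.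
  by rewrite big_nat1 big_ord0 addr0.
have e0 : (0 < epoch t)%N.
  by have := epoch_bounds t1; case: (epoch t) => //; lia.
have t1' := bstart_ge t1.
have p0 : (0 < bstart t)%N by have := expn_gt0 2 (epoch t); lia.
have {}IH := IH p0.
rewrite chainE// -cats1 big_cat big_seq1/=.
have le := level_le_epoch t.
rewrite [X in _ <= X + _ + _]big_ltn ?ltnS//.
rewrite -!addrA addrC lerD2l; apply: (le_trans IH); rewrite addrA lerD2r.
have [pE|pE] := eqVneq (bstart t) (2 ^ epoch t)%N.
  rewrite pE; case: (epoch t) e0 le => // k _ le.
  rewrite epochX (_ : level (2 ^ k.+1) = k); last first.
    by rewrite /level epochX expnS mul2n -addnn addnK pfactorK.
  rewrite big_nat1 big_ord_recr/= (addrC (g k)) lerDr.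
  by apply: sumr_ge0.
have pe : epoch (bstart t) = epoch t.
  by apply: trunc_log_eq => //; have := bstart_lt t0; have := epoch_bounds t1; lia.
rewrite pe lerD2r.
have lt : (level t < level (bstart t))%N.
  rewrite {2}/level pe -pfactor_dvdn//; last by move/eqP: pE; lia.
  have sE : (bstart t - 2 ^ epoch t = (t - 2 ^ epoch t) - 2 ^ level t)%N.
    by rewrite /bstart /bsize; lia.
  have := epoch_bounds t1 => /andP[e1 _].
  have [||a ca sa] := @pfactor_coprime 2 (t - 2 ^ epoch t); [by []|by lia|].
  rewrite sE sa -/(level t) -{2}[(2 ^ level t)%N]mul1n -mulnBl expnS.
  rewrite dvdn_pmul2r ?expn_gt0// dvdn2; move: ca; rewrite coprime2n.
  by case: a sa => // a _ /= ; rewrite subn1.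
have h : (level (bstart t) <= (epoch t).+1)%N by rewrite -pe leqW// level_le_epoch.
rewrite [leRHS](big_cat_nat lt h)/=.
by rewrite lerDr; apply: sumr_ge0.
Qed.

Lemma sum_chain_le (R : realType) (g : nat -> R) t : (forall j, 0 <= g j) -> (0 < t)%N ->
  \sum_(b <- chain t) g (level b) <= 3 * \sum_(j < (epoch t).+1) g j.
Proof.
move=> g0 t0; apply: (le_trans (sum_chain g0 t0)).
have h1 : \sum_(level t <= j < (epoch t).+1) g j <= \sum_(j < (epoch t).+1) g j.
  have h : (level t <= (epoch t).+1)%N by rewrite leqW// level_le_epoch.
  rewrite -(big_mkord xpredT g) [leRHS](big_cat_nat (leq0n _) h)/=.
  by rewrite lerDr; apply: sumr_ge0.
have h2 : \sum_(j < epoch t) g j <= \sum_(j < (epoch t).+1) g j.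
  by rewrite big_ord_recr lerDl.
have h3 : g 0%N <= \sum_(j < (epoch t).+1) g j.
  by rewrite big_ord_recl lerDl; apply: sumr_ge0.
by lra.
Qed.

End Blocks.

(** * The algorithm, its privacy and its accuracy *)

Section Algorithm.
Variables (R : realType) (d : nat) (eps : R).
Hypothesis eps0 : 0 < eps.
Hypothesis d0 : (0 < d)%N.
Local Notation X := (cube R d).

Lemma draws_ext (q q' : nat -> nat -> R) u m :
  (forall i, (i <= m)%N -> q i = q' i) -> draws q u m = draws q' u m.
Proof.
elim: m q q' u => [|m IH] q q' u qq' /=; rewrite (qq' 0%N)//.
by apply: IH => i im; exact: qq'.
Qed.

Section coding.
Variables (n L : nat) (eta : R).
Hypothesis eta0 : 0 < eta.
Local Notation reply := (reply d n L).

(** The replies to a block are coded by their ranks, since draws are integers. *)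
Definition decode (k : nat) : reply :=
  nth [ffun=> ord0] (enum reply) k.

Definition code_pmf (xs : seq X) (k : nat) : R :=
  if (k < #|reply|)%N then noise eta (block_count (L := L) xs) (decode k) else 0.

Lemma sum_code_pmf (xs : seq X) (g : reply -> R) :
  \sum_(k < #|reply|) code_pmf xs k * g (decode k) =
  \sum_(z : reply) noise eta (block_count (L := L) xs) z * g z.
Proof.
rewrite -[RHS]big_enum/= (big_nth [ffun=> ord0]) big_mkord -cardE.
by apply: eq_bigr => k _; rewrite /code_pmf ltn_ord.
Qed.

Lemma code_pmf_sum1 xs : \sum_(k < #|reply|) code_pmf xs k = 1.
Proof.
have := sum_code_pmf xs (fun=> 1).
under eq_bigr do rewrite mulr1.
under [X in _ = X]eq_bigr do rewrite mulr1.
by rewrite noise_sum1.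
Qed.

Lemma is_pmf_code xs : is_pmf (code_pmf xs).
Proof.
split=> [k|]; first by rewrite /code_pmf; case: ifP => // _; exact: noise_ge0.
exists #|reply|; split; first exact: code_pmf_sum1.
by move=> z; rewrite /code_pmf ltnNge => ->.
Qed.

End coding.

(** A large [eps] allows cells finer than the number of points suggests; depths are
    bounded by the epoch plus this integer, as [eps <= 2^slack]. *)
Definition slack : nat := (Num.truncn eps).+1.

(** A point of epoch [e] lies in at most [e + 1] blocks, each of depth at most
    [e + slack]; moving it changes two counts by one at every level, and each of
    these changes costs [2 * eta]. *)
Definition eta_epoch (e : nat) : R :=
  eps / (4 * e.+1%:R * (e.+1 + slack)%:R).

Definition eta t := eta_epoch (epoch t).

(** At the largest [L] for which [2^(L d)] is at most [eta n], the resolution [2^-L]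
    matches the noise; if there is none, the depth is [0]. *)
Definition depth (t : nat) : nat :=
  trunc_log (2 ^ d) (Num.truncn (eta t * (bsize t)%:R)).

Lemma eta_gt0 t : 0 < eta t.
Proof. by rewrite divr_gt0// !mulr_gt0. Qed.

Lemma eps_slack : eps <= 2 ^+ slack.
Proof.
have /andP[_ h] := truncn_itv (ltW eps0).
by rewrite (le_trans (ltW h))// -natrX ler_nat; exact/ltnW/ltn_expl.
Qed.

Lemma depth_le t : (depth t <= epoch t + slack)%N.
Proof.
rewrite /depth; set y := eta t * _.
have y0 : 0 <= y by rewrite mulr_ge0// ltW// eta_gt0.
have [->|k0] := posnP (Num.truncn y); first by rewrite trunc_log0.
have p1 : (1 < 2 ^ d)%N by rewrite -{1}(expn0 2) ltn_exp2l.
have /andP[h _] := trunc_log_bounds p1 k0.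
set l := trunc_log _ _ in h *.
have h1 : (2 ^ l <= (2 ^ d) ^ l)%N by rewrite -expnM leq_exp2l// leq_pmull.
have yb : y <= 2 ^+ (epoch t + slack).
  rewrite exprD mulrC /y; apply: (@le_trans _ _ (eps * (bsize t)%:R)).
    rewrite ler_wpM2r// /eta /eta_epoch ler_pdivrMr ?mulr_gt0//.
    rewrite ler_peMr ?(ltW eps0)// -!natrM ler1n; lia.
  apply: ler_pM => //; [exact: ltW|exact: eps_slack|].
  by rewrite -natrX ler_nat leq_exp2l// level_le_epoch.
rewrite -(@leq_exp2l 2)//; apply: (leq_trans (leq_trans h1 h)).
have /andP[ty _] := truncn_itv y0.
by rewrite -(ler_nat R) (le_trans ty)// natrX.
Qed.

Definition block (x : dataset R d) (t : nat) : seq X :=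
  map x (iota (bstart t) (bsize t)).

Lemma size_block x t : size (block x t) = bsize t.
Proof. by rewrite size_map size_iota. Qed.

(** Draw [m] belongs to the block closing at time [m + 1]. *)
Definition draw_law (x : dataset R d) (m : nat) : nat -> R :=
  code_pmf (bsize m.+1) (depth m.+1) (eta m.+1) (block x m.+1).

Lemma is_pmf_draw_law x m : is_pmf (draw_law x m).
Proof. by apply: is_pmf_code; exact: eta_gt0. Qed.

Definition synthetic_block (s : nat -> nat) (t : nat) : seq X :=
  fit R (decode (bsize t) (depth t) (s t.-1)).

Definition assemble (s : nat -> nat) (t : nat) : seq X :=
  flatten [seq synthetic_block s b | b <- chain t].

Lemma size_assemble s t : size (assemble s t) = t.
Proof.
rewrite size_flatten /shape -map_comp -[RHS](size_iota 0) -flatten_chain.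
rewrite size_flatten /shape -map_comp; congr sumn; apply: eq_map => b /=.
by rewrite size_fit size_iota.
Qed.

Definition release (s : nat -> nat) : outputs R d :=
  fun t => [tuple nth point (assemble s t) i | i < t].

Lemma val_mktuple_nth (T : Type) (x0 : T) (s : seq T) t : size s = t ->
  [tuple nth x0 s i | i < t] = s :> seq T.
Proof.
move=> <-; rewrite /= -[RHS](mkseq_nth x0) /mkseq -val_enum_ord -map_comp.
exact: eq_map.
Qed.

Lemma releaseE s t : release s t = assemble s t :> seq X.
Proof. by apply: val_mktuple_nth; exact: size_assemble. Qed.

Lemma release_ext s s' t : (forall i, (i < t)%N -> s i = s' i) ->
  release s t = release s' t.
Proof.
move=> ss'; apply/val_inj; rewrite [LHS]releaseE [RHS]releaseE /assemble.
congr flatten; apply/eq_in_map => b /chain_le bt.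
by rewrite /synthetic_block ss'//; lia.
Qed.

Lemma finitary_release : finitary release.
Proof. by move=> t; exists t => s s'; exact: release_ext. Qed.

(** The default value after time [t] is harmless: the outputs up to time [t] read
    only draws whose laws depend on the first [t] points ([run_algorithm]). *)
Definition extend t (xs : t.-tuple X) : dataset R d := nth point xs.

Definition synth_fun t (xs : t.-tuple X) (u : measurableTypeR R) : t.-tuple X :=
  release (draws (draw_law (extend xs)) u) t.

Lemma measurable_synth_fun t (xs : t.-tuple X) : measurable_fun setT (synth_fun xs).
Proof.
apply: (@measurable_finitary_fun _ _ t _ _ (fun s => release s t)).
  exact: is_pmf_draw_law.
by move=> s s'; apply: release_ext.
Qed.

Definition algorithm : online_algorithm R d :=
  @OnlineAlgorithm R d _ (measurableTypeR R) (@unit_law R) synth_fun measurable_synth_fun.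

Lemma draw_law_ext x x' m : (forall i, (i <= m)%N -> x i = x' i) ->
  draw_law x m = draw_law x' m.
Proof.
move=> xx'; rewrite /draw_law; congr code_pmf; apply/eq_in_map => i.
by rewrite mem_iota bstartK// ltnS => /andP[_]; exact: xx'.
Qed.

Lemma run_algorithm x u : run (M := algorithm) x u = release (draws (draw_law x) u).
Proof.
apply/functional_extensionality_dep => t; apply: release_ext => m mt.
apply: draws_ext => i im; apply: draw_law_ext => j ji.
rewrite /extend /data_upto.
have jt : (j < t)%N by lia.
by rewrite (nth_map (Ordinal jt)) ?size_enum_ord// nth_enum_ord.
Qed.

Lemma code_pmf_dp n L e (I : seq nat) (x x' : dataset R d) k z : 0 < e -> uniq I ->
  (forall i, i != k -> x i = x' i) ->
  code_pmf n L e (map x I) z <=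
  expR (2 * e * (2 * L * (k \in I))%N%:R) * code_pmf n L e (map x' I) z.
Proof.
move=> e0 uI xx'; rewrite /code_pmf; case: ifP => [_|]; last by rewrite mulr0.
apply: (le_trans (noise_dp _ (block_count (map x' I)) _ e0)).
apply: ler_wpM2r; first exact: noise_ge0.
rewrite ler_expR; apply: ler_wpM2l; first by rewrite mulr_ge0// ltW.
by rewrite ler_nat; exact: block_count_sensitivity.
Qed.

(** Only blocks that contain the changed point [k] see a different law, and none of
    them ends after the epoch of [k], which leaves finitely many draws. *)
Lemma algorithm_private : differentially_private eps algorithm.
Proof.
move=> x x' [k xk] S mS.
have runE y : run (M := algorithm) y @^-1` S = [set u | S (release (draws (draw_law y) u))].
  by apply/seteqP; split => u /=; rewrite run_algorithm.
pose e := trunc_log 2 k.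
pose c m : R := 2 * eta m.+1 * (2 * depth m.+1 * covers k m.+1)%N%:R.
have memI m : (k \in iota (bstart m.+1) (bsize m.+1)) = covers k m.+1.
  by rewrite mem_iota bstartK.
have := @dp_draws R (2 ^ e.+1) (draw_law x) (draw_law x') c d release S
  (is_pmf_draw_law x) (is_pmf_draw_law x') finitary_release mS.
rewrite (runE x) (runE x').
move=> h; apply: (le_trans (h _ _)).
- move=> m z; rewrite /c -memI; apply: code_pmf_dp => //; [exact: eta_gt0|exact: iota_uniq].
- move=> m em; rewrite /draw_law /block; congr code_pmf; apply/eq_in_map => i iI.
  apply: xk; apply: contraTneq iI => ->; rewrite memI; apply/negP => cm.
  have ke := covers_epoch cm; rewrite -/e in ke.
  have [m1|m1] := ltnP 1 m.+1.
    by have := epoch_bounds m1; rewrite ke; lia.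
  by have := expn_gt0 2 e.+1; lia.
apply: lee_wpmul2r; first exact: measure_ge0.
rewrite lee_fin ler_expR.
pose b : R := 4 * (e + slack)%:R * eta_epoch e.
have b0 : 0 <= b by rewrite mulr_ge0// ltW// divr_gt0// !mulr_gt0.
apply: (@le_trans _ _ (\sum_(m < 2 ^ e.+1) b * (covers k m.+1)%:R)).
  apply: ler_sum => m _; rewrite /c; case: (boolP (covers k m.+1)) => [cm|_]; last first.
    by rewrite muln0 !mulr0.
  rewrite muln1 mulr1 /b /eta (covers_epoch cm) -/e.
  have := depth_le m.+1; rewrite (covers_epoch cm) -/e -(ler_nat R) natrM => h1.
  have : 0 <= eta_epoch e by rewrite ltW// divr_gt0// !mulr_gt0.
  set H := eta_epoch e; set D := (depth _)%:R in h1 *; set F := (_ + _)%:R in h1 *.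
  by move=> H0; have := ler_wpM2l H0 h1; lra.
rewrite -mulr_sumr -natr_sum.
apply: (@le_trans _ _ (b * e.+1%:R)).
  by apply: ler_wpM2l => //; rewrite ler_nat sum_covers.
rewrite /b /eta_epoch.
have A0 : e.+1%:R != 0 :> R by rewrite pnatr_eq0.
have B0 : (e.+1 + slack)%:R != 0 :> R by rewrite pnatr_eq0.
have F (A B D : R) : A != 0 -> B != 0 -> 4 * D * (eps / (4 * A * B)) * A = eps * (D / B).
  by move=> ? ?; field; apply/andP.
rewrite F//.
by rewrite ler_piMr ?(ltW eps0)// ler_pdivrMr// mul1r ler_nat.
Qed.

Lemma matching_flatten (cs : seq nat) (f g : nat -> seq X) (c : nat -> R) :
  (forall b, exists ps : seq (X * X), [/\ perm_eq (f b) (unzip1 ps),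
     perm_eq (g b) (unzip2 ps) & \sum_(p <- ps) rho p.1 p.2 <= c b]) ->
  exists ps : seq (X * X), [/\ perm_eq (flatten (map f cs)) (unzip1 ps),
     perm_eq (flatten (map g cs)) (unzip2 ps) &
     \sum_(p <- ps) rho p.1 p.2 <= \sum_(b <- cs) c b].
Proof.
move=> H; elim: cs => [|b cs [ps [p1 p2 pc]]].
  by exists [::]; rewrite !big_nil.
have [qs [q1 q2 qc]] := H b; exists (qs ++ ps); split => /=.
- by rewrite /unzip1 map_cat perm_cat.
- by rewrite /unzip2 map_cat perm_cat.
- by rewrite big_cat big_cons lerD.
Qed.

Definition block_bound (t : nat) : R :=
  (bsize t)%:R * 2^-1 ^+ depth t +
  2 / eta t * \sum_(l < depth t) 2^-1 ^+ l.+1 * (2 ^+ l.+1) ^+ d.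

Lemma score_ge0 n L (xs : seq X) (z : reply d n L) : 0 <= score xs z.
Proof. by apply: sumr_ge0 => j _; rewrite mulr_ge0// exprn_ge0. Qed.

(** The matchings of the blocks combine to a matching of the whole prefix, and by
    linearity only the law of each single draw matters for the expectation. *)
Lemma algorithm_accuracy x t : (0 < t)%N ->
  (expected_W1 algorithm x t <= (t%:R^-1 * \sum_(b <- chain t) block_bound b)%:E)%E.
Proof.
move=> t0.
pose cost b (k : nat) : R := t%:R^-1 * ((bsize b)%:R * 2^-1 ^+ depth b +
   score (block x b) (decode (bsize b) (depth b) k)).
have cost0 b k : 0 <= cost b k.
  by rewrite mulr_ge0 ?invr_ge0// addr_ge0 ?score_ge0// mulr_ge0// exprn_ge0.
pose g (u : measurableTypeR R) : \bar R :=
  (\sum_(b <- chain t) (cost b (draws (draw_law x) u b.-1))%:E)%E.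
have mcost b : measurable_fun setT
    (fun u : measurableTypeR R => (cost b (draws (draw_law x) u b.-1))%:E).
  by apply/measurable_EFinP; apply: measurable_fun_draws; exact: is_pmf_draw_law.
apply: (@le_trans _ _ (\int[@unit_law R]_u g u)%E).
  apply: le_upper_integral => [u||u]; first exact: W1_ge0.
    exact: emeasurable_sum.
  have [ps [p1 p2 pc]] := @matching_flatten (chain t) (block x)
    (synthetic_block (draws (draw_law x) u)) _
    (fun b => fit_matching (decode (bsize b) (depth b) (draws (draw_law x) u b.-1))
      (size_block x b)).
  apply: (@le_trans _ _ (t%:R^-1 * \sum_(p <- ps) rho p.1 p.2)%:E).
    apply: W1_matching => //.
      apply: perm_trans p1; rewrite /data_upto /block.
      rewrite (_ : [seq [seq x i | i <- iota (bstart b) (bsize b)] | b <- chain t] =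
         map (map x) [seq iota (bstart b) (bsize b) | b <- chain t]); last by rewrite -map_comp.
      rewrite -map_flatten flatten_chain -val_enum_ord -map_comp.
      by rewrite perm_refl.
    by rewrite run_algorithm releaseE.
  rewrite /g sumEFin lee_fin -mulr_sumr.
  by apply: ler_wpM2l; [rewrite invr_ge0|exact: pc].
rewrite /g ge0_integral_sum//; last first.
  by move=> b u _; rewrite lee_fin.
rewrite mulr_sumr -sumEFin !big_seq; apply: lee_sum => b /chain_le /andP[b0 _].
rewrite (@integral_draws _ _ _ #|reply d (bsize b) (depth b)| (cost b))//; last 2 first.
- by move=> i; exact: is_pmf_draw_law.
- by rewrite /draw_law prednK// code_pmf_sum1// eta_gt0.
rewrite lee_fin /draw_law prednK//.
pose h (z : reply d (bsize b) (depth b)) : R :=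
  t%:R^-1 * ((bsize b)%:R * 2^-1 ^+ depth b + score (block x b) z).
rewrite (sum_code_pmf _ _ h) /h.
under eq_bigr do rewrite mulrCA mulrDr.
rewrite -mulr_sumr big_split/= -mulr_suml noise_sum1 ?eta_gt0// mul1r.
apply: ler_wpM2l; first by rewrite invr_ge0.
rewrite lerD2l; apply: expected_score; first exact: eta_gt0.
exact: size_block.
Qed.

End Algorithm.

(** * Rates *)

Section Rates.
Variable R : realType.

Lemma ln2_ge_half : 2^-1 <= ln 2 :> R.
Proof.
have h := @le_ln1Dx R (- 2^-1).
have e : 1 + - 2^-1 = 2^-1 :> R by field.
by move: h; rewrite e lnV ?posrE// lerN2; apply; lra.
Qed.

Lemma natr_ln_le e (x : R) : 2 ^+ e <= x -> e%:R <= 2 * ln x.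
Proof.
move=> ex; have p0 : 0 < 2 ^+ e :> R by rewrite exprn_gt0.
have : ln (2 ^+ e : R) <= ln x by rewrite ler_ln ?posrE//; exact: lt_le_trans ex.
rewrite lnXn// -[ln 2 *+ e]mulr_natl => h.
have := ler_wpM2l (ler0n R e) ln2_ge_half; lra.
Qed.

Section root.
Variable d : nat.
Hypothesis d0 : (0 < d)%N.

Definition iroot (y : R) : R := y `^ (- d%:R^-1).

Lemma iroot_gt0 y : 0 < y -> 0 < iroot y.
Proof. exact: powR_gt0. Qed.

Lemma irootM x y : 0 <= x -> 0 <= y -> iroot (x * y) = iroot x * iroot y.
Proof. by move=> x0 y0; rewrite /iroot powRM. Qed.

Lemma irootXd z : 0 < z -> iroot (z ^+ d) = z^-1.
Proof.
move=> z0; rewrite /iroot -powR_mulrn ?ltW// -powRrM mulrN divff ?pnatr_eq0 -?lt0n//.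
by rewrite powR_inv1 ?ltW.
Qed.

Lemma iroot_anti x y : 0 < x -> x <= y -> iroot y <= iroot x.
Proof.
move=> x0 xy; have y0 := lt_le_trans x0 xy.
rewrite /iroot !powRN lef_pV2 ?posrE ?powR_gt0//.
by apply: ge0_ler_powR; rewrite ?nnegrE ?invr_ge0// ltW.
Qed.

Lemma irootX x j : 0 <= x -> iroot (x ^+ j) = iroot x ^+ j.
Proof.
move=> x0; elim: j => [|j IH]; first by rewrite !expr0 /iroot powR1.
by rewrite !exprS irootM ?exprn_ge0// IH.
Qed.

Lemma iroot_ge x z : 0 < x -> 0 < z -> x <= z ^+ d -> z^-1 <= iroot x.
Proof. by move=> x0 z0 xz; rewrite -irootXd//; exact: iroot_anti. Qed.

Lemma iroot_le x z : 0 < z -> z ^+ d <= x -> iroot x <= z^-1.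
Proof. by move=> z0 xz; rewrite -irootXd//; apply: iroot_anti => //; exact: exprn_gt0. Qed.

End root.

Lemma sum_levels_le d L : (1 < d)%N ->
  \sum_(l < L) (2^-1 ^+ l.+1 * (2 ^+ l.+1) ^+ d) <= 2 * (2^-1 ^+ L * (2 ^+ L) ^+ d) :> R.
Proof.
case: d => [|[|d]] // _.
have E l : 2^-1 ^+ l * (2 ^+ l) ^+ d.+2 = (2 ^+ d.+1) ^+ l :> R.
  rewrite exprS mulrA -exprMn mulVf// expr1n mul1r -!exprM mulnC //.
under eq_bigr do rewrite E.
rewrite E; elim: L => [|L IH]; first by rewrite big_ord0 mulr_ge0.
rewrite big_ord_recr/=.
have h : 2 * (2 ^+ d.+1) ^+ L <= (2 ^+ d.+1) ^+ L.+1 :> R.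
  rewrite [leRHS]exprS; apply: ler_wpM2r; first by rewrite !exprn_ge0.
  by rewrite exprS ler_peMr// exprn_ege1// ler1n.
lra.
Qed.

Lemma sum_geometric_le (b : R) e : 4 / 3 <= b -> \sum_(j < e.+1) b ^+ j <= 4 * b ^+ e.
Proof.
move=> b1; elim: e => [|e IH]; first by rewrite big_ord1 expr0; lra.
rewrite big_ord_recr/=.
have : b ^+ e * (4 / 3) <= b ^+ e.+1 by rewrite exprSr ler_wpM2l// exprn_ge0//; lra.
by lra.
Qed.

Section bounds.
Variables (d : nat) (eps : R).
Hypotheses (d0 : (0 < d)%N) (eps0 : 0 < eps).
Local Notation eta := (eta eps).
Local Notation depth := (depth d eps).
Local Notation slack := (slack eps).
Local Notation block_bound := (block_bound d eps).

Let p1 : (1 < 2 ^ d)%N. Proof. by rewrite -{1}(expn0 2) ltn_exp2l. Qed.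

Lemma depth_upper b : eta b * (bsize b)%:R <= (2 ^+ (depth b).+1) ^+ d.
Proof.
rewrite /depth; set y := _ * _.
have y0 : 0 <= y by rewrite mulr_ge0// ltW// eta_gt0.
have /andP[_ /ltW h] := truncn_itv y0; apply: (le_trans h).
rewrite -exprM mulnC exprM -!natrX ler_nat.
have [->|k0] := posnP (Num.truncn y); first by rewrite trunc_log0 expn1 ltnW.
by have /andP[_] := trunc_log_bounds p1 k0.
Qed.

Lemma depth_lower b : (0 < depth b)%N -> (2 ^+ depth b) ^+ d <= eta b * (bsize b)%:R.
Proof.
rewrite /depth; set y := _ * _ => L0.
have y0 : 0 <= y by rewrite mulr_ge0// ltW// eta_gt0.
have k0 : (0 < Num.truncn y)%N by rewrite lt0n; apply: contraTneq L0 => ->; rewrite trunc_log0.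
have /andP[h _] := trunc_log_bounds p1 k0.
have /andP[h' _] := truncn_itv y0; apply: le_trans h'.
by rewrite -exprM mulnC exprM -!natrX ler_nat.
Qed.

Lemma eta_epoch_anti e e' : (e <= e')%N -> eta_epoch eps e' <= eta_epoch eps e.
Proof.
move=> ee; rewrite /eta_epoch ler_pM2l// lef_pV2 ?posrE ?mulr_gt0//.
by rewrite -!mulrA ler_pM2l// -!natrM ler_nat leq_mul//; lia.
Qed.

Lemma eta_epoch_gt0 e : 0 < eta_epoch eps e.
Proof. by rewrite divr_gt0// !mulr_gt0. Qed.

(** The sum over the levels is dominated by the deepest one, which the choice of the
    depth makes comparable to [n 2^-L]. *)
Lemma block_bound_multi e b : (1 < d)%N -> (epoch b <= e)%N ->
  block_bound b <= 10 * iroot d (eta_epoch eps e) * (2 * iroot d 2) ^+ level b.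
Proof.
move=> d1 be; have e0 := eta_gt0 eps0 b.
set n : R := (bsize b)%:R; have n0 : 0 < n by rewrite ltr0n bsize_gt0.
have h1 : block_bound b <= 5 * (n * 2^-1 ^+ depth b).
  rewrite /block_bound -/n; have [L0|L0] := posnP (depth b).
    by rewrite L0 big_ord0 mulr0 addr0 expr0; lra.
  suff : 2 / eta b * \sum_(l < depth b) 2^-1 ^+ l.+1 * (2 ^+ l.+1) ^+ d <=
      4 * (n * 2^-1 ^+ depth b) by lra.
  rewrite mulrAC ler_pdivrMr//.
  have := sum_levels_le (depth b) d1; have := depth_lower L0.
  set S := \sum_(l < _) _; set P := (2 ^+ _) ^+ d; set Q := _ ^+ depth b => h3 h4.
  have Q0 : 0 <= Q by rewrite exprn_ge0.
  have := ler_wpM2l Q0 h3; rewrite -/n => h5.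
  by apply: (@le_trans _ _ (2 * (2 * (Q * P)))); [rewrite ler_pM2l|lra].
have h2 : 2^-1 ^+ depth b <= 2 * iroot d (eta b * n).
  have : (2 ^+ (depth b).+1)^-1 <= iroot d (eta b * n).
    by apply: iroot_ge => //; [exact: mulr_gt0|exact: depth_upper].
  by rewrite exprS invfM exprVn; lra.
have h3 : iroot d (eta b * n) <= iroot d (eta_epoch eps e) * iroot d n.
  have h0 := eta_epoch_gt0 e.
  rewrite -irootM ?(ltW h0) ?(ltW n0)//; apply: iroot_anti; first exact: mulr_gt0.
  by rewrite ler_pM2r//; exact: eta_epoch_anti.
apply: (le_trans h1).
have -> : (2 * iroot d 2) ^+ level b = n * iroot d n.
  by rewrite exprMn -irootX// /n /bsize natrX.
have := ler_wpM2l (ltW n0) (le_trans h2 (ler_wpM2l (ler0n _ 2) h3)).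
by lra.
Qed.

(** In dimension one every level contributes the same amount [2 / eta]. *)
Lemma block_bound_line e b : d = 1%N -> (epoch b <= e)%N ->
  block_bound b <= 2 * (e.+1 + slack)%:R / eta_epoch eps e.
Proof.
move=> d1 be; have e0 := eta_gt0 eps0 b; have h0 := eta_epoch_gt0 e.
have dX (z : R) : z ^+ d = z by rewrite d1 expr1.
set n : R := (bsize b)%:R.
have h1 : n * 2^-1 ^+ depth b <= 2 / eta b.
  have := depth_upper b; rewrite dX exprS -/n => h.
  rewrite exprVn ler_pdivrMr ?exprn_gt0// mulrAC ler_pdivlMr//; lra.
have h2 : \sum_(l < depth b) 2^-1 ^+ l.+1 * (2 ^+ l.+1) ^+ d = (depth b)%:R :> R.
  rewrite (eq_bigr (fun=> 1)) => [|l _]; first by rewrite sumr_const card_ord.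
  by rewrite dX -exprMn mulVf// expr1n.
rewrite /block_bound -/n h2.
have h3 : (depth b)%:R + 1 <= (e.+1 + slack)%:R :> R.
  by rewrite natr1 ler_nat; have := depth_le eps0 d0 b; lia.
apply: (@le_trans _ _ (2 * (e.+1 + slack)%:R / eta b)).
  rewrite [leRHS]mulrAC; set c := 2 / eta b in h1 *.
  have c0 : 0 <= c by rewrite divr_ge0// ltW.
  by have := ler_wpM2l c0 h3; lra.
apply: ler_wpM2l; first by rewrite mulr_ge0.
by rewrite lef_pV2 ?posrE//; exact: eta_epoch_anti.
Qed.

Lemma chain_bound_le (g : nat -> R) t : (0 < t)%N -> (forall j, 0 <= g j) ->
  (forall b, (epoch b <= epoch t)%N -> block_bound b <= g (level b)) ->
  \sum_(b <- chain t) block_bound b <= 3 * \sum_(j < (epoch t).+1) g j.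
Proof.
move=> t0 g0 bg; apply: le_trans (sum_chain_le g0 t0).
rewrite big_seq [leRHS]big_seq; apply: ler_sum => b /chain_le /andP[_ bt].
by apply: bg; exact: epoch_le.
Qed.

(** The three terms give [1 <= ln t], [slack <= epoch t + 1] and
    [sqrt t <= eps * t]. *)
Definition threshold : R := 4 + 2 ^+ slack + eps ^- 2.

Section large.
Variable t : nat.
Hypothesis tC : threshold <= t%:R.

Let t4 : 4 <= t%:R :> R.
Proof.
apply: le_trans tC; rewrite /threshold -addrA lerDl addr_ge0 ?exprn_ge0//.
by rewrite invr_ge0 exprn_ge0// ltW.
Qed.

Let t4n : (3 < t)%N. Proof. by rewrite -(ltr_nat R); have := t4; lra. Qed.

Lemma epoch_ge1 : (0 < epoch t)%N.
Proof.
have t1 : (1 < t)%N by lia.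
by have := epoch_bounds t1; case: (epoch t) => //; lia.
Qed.

Lemma slack_le_epoch : (slack <= (epoch t).+1)%N.
Proof.
have t1 : (1 < t)%N by lia.
rewrite -(@leq_exp2l 2)//; have /andP[_] := epoch_bounds t1; apply: leq_trans.
rewrite -(ler_nat R) natrX; apply: le_trans tC; rewrite /threshold.
have : 0 <= eps ^- 2 by rewrite invr_ge0 exprn_ge0// ltW.
by lra.
Qed.

Lemma epoch_ln : (epoch t).+1%:R <= 4 * ln t%:R :> R.
Proof.
have t1 : (1 < t)%N by lia.
have /andP[/ltnW h _] := epoch_bounds t1.
have := @natr_ln_le (epoch t) t%:R; rewrite -natrX ler_nat => /(_ h).
have := epoch_ge1; rewrite -(ler1n R) -[(epoch t).+1%:R]natr1; lra.
Qed.

Lemma ln_ge1 : 1 <= ln t%:R :> R.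
Proof.
have h : (2 ^+ 2 : R) <= t%:R by have := t4; rewrite expr2; lra.
have h2 : (2 : R) <= 2 * ln t%:R := natr_ln_le h.
by lra.
Qed.

Lemma ln_eps : ln t%:R <= 2 * ln (eps * t%:R).
Proof.
have tp : 0 < t%:R :> R by have := t4; lra.
have ep : 0 < eps * t%:R by rewrite mulr_gt0.
have e2 : 0 < eps ^+ 2 by rewrite exprn_gt0.
rewrite mulr_natl -lnXn// ler_ln ?posrE ?exprn_gt0// exprMn.
have : eps ^- 2 <= t%:R.
  by apply: le_trans tC; rewrite /threshold lerDr addr_ge0// exprn_ge0.
rewrite -[_ ^- 2]mul1r ler_pdivrMr// => h.
by have := ler_wpM2r (ltW tp) h; rewrite mul1r mulrAC; lra.
Qed.

Lemma eta_epoch_large : eps / (8 * (epoch t).+1%:R ^+ 2) <= eta_epoch eps (epoch t).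
Proof.
rewrite /eta_epoch ler_pM2l// lef_pV2 ?posrE ?mulr_gt0// ?exprn_gt0//.
have := slack_le_epoch; rewrite -(ler_nat R) natrD.
set x := _.+1%:R; set s := slack%:R => h.
have x0 : 0 <= x by [].
by have := ler_wpM2l x0 h; lra.
Qed.

(** The costs of the blocks form a geometric sum of ratio [2^(1 - 1/d) >= 4/3], which
    the largest block dominates; then [(e^2)^(1/d) <= e] turns the loss in [eta] into
    a single logarithm. *)
Lemma chain_bound_multi : (1 < d)%N ->
  t%:R^-1 * (\sum_(b <- chain t) block_bound b) <=
  2880 * (ln t%:R * iroot d (eps * t%:R)).
Proof.
move=> d1; set e := epoch t; set h := eta_epoch eps e; set be := 2 * iroot d 2.
have t1 : (1 < t)%N by lia.
have tp : 0 < t%:R :> R by have := t4; lra.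
have h0 : 0 < h by exact: eta_epoch_gt0.
have be43 : 4 / 3 <= be.
  have : (3 / 2)^-1 <= iroot d 2.
    apply: iroot_ge => //; rewrite ?divr_gt0//.
    have : (3 / 2 : R) ^+ 2 <= (3 / 2) ^+ d by apply: ler_weXn2l => //; lra.
    by rewrite expr2; lra.
  by rewrite /be invf_div; lra.
have be0 : 0 <= be by lra.
have S : \sum_(b <- chain t) block_bound b <= 120 * (iroot d h * be ^+ e).
  apply: (le_trans (@chain_bound_le (fun j => 10 * iroot d h * be ^+ j) t _ _ _)).
  - by lia.
  - by move=> j; rewrite !mulr_ge0 ?exprn_ge0// ltW// iroot_gt0.
  - by move=> b; exact: block_bound_multi.
  rewrite -mulr_sumr.
  have := ler_wpM2l (ltW (iroot_gt0 d h0)) (sum_geometric_le e be43).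
  by rewrite -/e; lra.
have B : be ^+ e <= t%:R * (2 * iroot d t%:R).
  have /andP[e1 e2] := epoch_bounds t1; rewrite -/e in e1 e2.
  rewrite /be exprMn -irootX//; apply: ler_pM.
  - by rewrite exprn_ge0.
  - by rewrite ltW// iroot_gt0// exprn_gt0.
  - by rewrite -natrX ler_nat ltnW.
  have : iroot d (2 * 2 ^+ e) <= iroot d t%:R.
    by apply: iroot_anti => //; rewrite -exprS -natrX ler_nat.
  rewrite irootM ?exprn_ge0// => h1.
  have h2 : 2^-1 <= iroot d 2.
    apply: iroot_ge => //; rewrite -[leLHS]expr1; apply: ler_weXn2l => //; lra.
  have := ler_wpM2r (ltW (iroot_gt0 d (exprn_gt0 e (ltr0n R 2)))) h2; lra.
have H : iroot d (h * t%:R) <= 3 * e.+1%:R * iroot d (eps * t%:R).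
  have ee : 0 < 8 * e.+1%:R ^+ 2 :> R by rewrite mulr_gt0// exprn_gt0.
  apply: (@le_trans _ _ (iroot d ((8 * e.+1%:R ^+ 2)^-1 * (eps * t%:R)))).
    apply: iroot_anti; first by apply: mulr_gt0; [rewrite invr_gt0|exact: mulr_gt0].
    by rewrite mulrA ler_pM2r// mulrC; exact: eta_epoch_large.
  rewrite irootM; [|by rewrite invr_ge0 ltW|by rewrite mulr_ge0// ltW].
  apply: ler_wpM2r; first by rewrite ltW// iroot_gt0// mulr_gt0.
  rewrite -[leRHS]invrK; apply: iroot_le => //.
  have z0 : 0 <= (3 * e.+1%:R : R)^-1 by rewrite invr_ge0 mulr_ge0.
  have e1 : 1 <= e.+1%:R :> R by rewrite ler1n.
  apply: (@le_trans _ _ ((3 * e.+1%:R)^-1 ^+ 2)).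
    by apply: ler_wiXn2l => //; rewrite invf_le1; lra.
  rewrite exprVn lef_pV2 ?posrE// ?exprn_gt0 ?mulr_gt0// exprMn.
  by apply: ler_wpM2r; [rewrite exprn_ge0|lra].
rewrite mulrC ler_pdivrMr//; apply: (le_trans S).
have ih0 := ltW (iroot_gt0 d h0).
have ie0 : 0 <= iroot d (eps * t%:R) by rewrite ltW// iroot_gt0// mulr_gt0.
have := ler_wpM2l ih0 B.
rewrite irootM ?(ltW h0) ?(ltW tp)// in H.
have := ler_wpM2r ie0 epoch_ln; rewrite -/e => L.
have H' : iroot d h * iroot d t%:R <= 12 * ln t%:R * iroot d (eps * t%:R) by lra.
have := ler_wpM2r (ltW tp) H'.
by lra.
Qed.

(** With [x = epoch t + 1] the total is [O(x^4 / eps)] and [x = O(ln t)]; of the four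
    logarithms three are compared with [ln (eps * t)] and one with
    [(ln t)^(3/2)]. *)
Lemma chain_bound_line : d = 1%N ->
  t%:R^-1 * (\sum_(b <- chain t) block_bound b) <=
  (48 * 64 * 64) * (ln (eps * t%:R) ^+ 3 * ln t%:R `^ (3 / 2) * (eps * t%:R)^-1).
Proof.
move=> d1; set e := epoch t; set h := eta_epoch eps e.
have tp : 0 < t%:R :> R by have := t4; lra.
have h0 : 0 < h by exact: eta_epoch_gt0.
set c : R := 2 * (e.+1 + slack)%:R / h.
have c0 : 0 <= c by rewrite divr_ge0// ltW.
have S : \sum_(b <- chain t) block_bound b <= 3 * (e.+1%:R * c).
  apply: (le_trans (@chain_bound_le (fun=> c) t _ _ _)) => //; first by lia.
    by move=> b; exact: block_bound_line.
  by rewrite sumr_const card_ord -[c *+ _]mulr_natl.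
set x : R := e.+1%:R; have x1 : 1 <= x by rewrite ler1n.
have sx : (e.+1 + slack)%:R <= 2 * x :> R.
  by rewrite natrD -/x; have := slack_le_epoch; rewrite -(ler_nat R) -/e -/x; lra.
have cx : c <= 32 * x ^+ 3 / eps.
  rewrite /c; apply: (@le_trans _ _ (4 * x / h)).
    by apply: ler_wpM2r; [rewrite invr_ge0 ltW|lra].
  rewrite ler_pdivrMr// mulrAC ler_pdivlMr//.
  have xx : 0 < 8 * x ^+ 2 by rewrite mulr_gt0// exprn_gt0//; lra.
  have := eta_epoch_large; rewrite -/e -/x -/h ler_pdivrMr// => hh.
  have x0 : 0 <= 4 * x by lra.
  by have := ler_wpM2l x0 hh; rewrite !exprS expr0; lra.
have S2 : \sum_(b <- chain t) block_bound b <= 96 * x ^+ 4 / eps.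
  apply: (le_trans S); have x0 : 0 <= x by lra.
  by have := ler_wpM2l x0 cx; rewrite -/x !exprS expr0; lra.
have l1 := ln_ge1; set l := ln t%:R in l1 *; have l2 := ln_eps; rewrite -/l in l2.
set k := ln (eps * t%:R) in l2 *.
have x4 : x ^+ 4 <= 256 * l ^+ 4.
  have -> : 256 * l ^+ 4 = (4 * l) ^+ 4 by ring.
  by apply: lerXn2r; rewrite ?nnegrE; [lra|lra|exact: epoch_ln].
have k3 : l ^+ 3 <= 8 * k ^+ 3.
  have -> : 8 * k ^+ 3 = (2 * k) ^+ 3 by ring.
  by apply: lerXn2r; rewrite ?nnegrE; lra.
have lp : l <= l `^ (3 / 2).
  by rewrite -{1}(@powRr1 _ l) ?ler_powR//; lra.
have l4 : l ^+ 4 <= 8 * k ^+ 3 * l `^ (3 / 2).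
  rewrite exprSr; apply: ler_pM => //; [rewrite exprn_ge0//|]; lra.
have E : 48 * 64 * 64 * (k ^+ 3 * l `^ (3 / 2) * (eps * t%:R)^-1) =
    (48 * 64 * 64 * (k ^+ 3 * l `^ (3 / 2))) / eps / t%:R by rewrite invfM; ring.
rewrite E mulrC; apply: ler_wpM2r; first by rewrite invr_ge0 ltW.
apply: (le_trans S2); apply: ler_wpM2r; first by rewrite invr_ge0 ltW.
by lra.
Qed.

End large.
End bounds.
End Rates.

Theorem theorem1p1 (R : realType) :
  exists C : R, 0 < C /\
  exists Ceps : R -> R,
  forall (d : nat) (eps : R), (1 <= d)%N -> 0 < eps ->
  exists M : online_algorithm R d,
    differentially_private eps M /\
    forall (x : dataset R d) (t : nat), (1 <= t)%N -> Ceps eps <= t%:R ->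
      (expected_W1 M x t <= (C * accuracy_rate d eps t)%:E)%E.
Proof.
exists (48 * 64 * 64); split; first by lra.
exists (@threshold R) => d eps d0 eps0.
exists (algorithm eps0 d0); split; first exact: algorithm_private.
move=> x t t0 tC; apply: (le_trans (algorithm_accuracy eps0 d0 x t0)).
rewrite lee_fin /accuracy_rate; case: eqP => [d1|d1].
  exact: chain_bound_line.
apply: (le_trans (chain_bound_multi d0 eps0 tC _)); first by lia.
apply: ler_wpM2r; last by lra.
rewrite mulr_ge0 ?powR_ge0//.
by apply: le_trans (ln_ge1 eps0 tC).
Qed.
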